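(* Let $n=2m+1$ with $m$ a positive integer, let $S\subseteq D_n$ be non-empty with $1\notin S$ and $S=S^{-1}$, and suppose that $\mathrm{Cay}(D_n,S)$ is non-normal. Then $\mathrm{Cay}(D_n,S)$ exhibits PST between the vertices $u$ and $v$ at time $\tau$ if and only if exactly one of the following holds. (A) $(u,v)\in(G_0\times G_0)\cup(G_1\times G_1)$ with $u-v=\pm m$, and the eigenvalues of the discriminant matrix $P$ satisfy (i) $T_\tau(\widetilde\mu_1)=T_\tau(\widetilde\mu_2)=1$; (ii) $T_\tau(\mu_h)=(-1)^h$ for $1\le h\le m$ with $\eta_h(S_2)=0$; and (iii) $T_\tau(\mu_h^{(1)})=T_\tau(\mu_h^{(2)})=(-1)^h$ for $1\le h\le m$ with $\eta_h(S_2)\ne0$. (B) $(u,v)\in(G_0\times G_1)\cup(G_1\times G_0)$ with $\eta_h(S_2)\neq0$ for each $1\le h\le m$ and $S_2=a^{2|v-u|}S_2^{-1}$, and the eigenvalues of $P$ satisfy (i) $T_\tau(\widetilde\mu_1)=-T_\tau(\widetilde\mu_2)=1$; and (ii) $T_\tau(\mu_h^{(1)})=-T_\tau(\mu_h^{(2)})=\ell_h\,\omega_n^{|v-u|h}$ for $1\le h\le m$.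
   Context: Grover walk and PST. For a finite simple graph $G$, let $\mathcal{A}(G)=\{(u,v),(v,u):\{u,v\}\in E(G)\}$ be the set of arcs; for $a=(u,v)$ put $t(a)=v$ and $\bar a=(v,u)$. The shift matrix $R\in\mathbb{C}^{\mathcal{A}(G)\times\mathcal{A}(G)}$ has $R_{a,b}=1$ if $a=\bar b$ and $0$ otherwise. The boundary matrix $N\in\mathbb{C}^{V(G)\times\mathcal{A}(G)}$ has $N_{u,a}=1/\sqrt{\deg u}$ if $t(a)=u$ and $0$ otherwise. The transition matrix of the Grover walk is $U=R(2N^*N-I)$. The discriminant is $P=NRN^*$, which for a $k$-regular graph equals $\frac1k A$ with $A$ the adjacency matrix. For a vertex $u$, $\Phi_u=N^*\mathbf{e}_u$. $G$ exhibits perfect state transfer (PST) from $u$ to another vertex $v\ne u$ at time $\tau$ ($\tau$ a positive integer) if $U^\tau\Phi_u=\gamma\Phi_v$ for some $\gamma\in\mathbb{C}$ with $|\gamma|=1$; this relation is symmetric in $u,v$, so one says PST between $u$ and $v$. $T_k$ is the Chebyshev polynomial of the first kind. Dihedral Cayley graphs. $D_n=\langle a,b:a^n=1=b^2,\ bab=a^{-1}\rangle$ has order $2n$; $\omega_n=e^{2\pi\sqrt{-1}/n}$. $\mathrm{Cay}(D_n,S)$ has vertex set $D_n$ and edges $\{x,y\}$ with $xy^{-1}\in S$; it is normal if $S$ is a union of conjugacy classes of $D_n$, otherwise non-normal. Vertices are labelled by integers: $u\in G_0:=\{0,\ldots,n-1\}$ stands for $a^u$, and $u\in G_1:=\{n,\ldots,2n-1\}$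 stands for $ba^{u-n}$. Let $d=|S|$, $S_1=S\cap\langle a\rangle$, $S_2=bS\cap\langle a\rangle$ with $bS=\{bs:s\in S\}$, $S_2^{-1}=\{x^{-1}:x\in S_2\}$, $s_i=|S_i|$. For $C\subseteq\langle a\rangle$, $\eta_h(C)=\sum_{0\le k\le n-1,\ a^k\in C}\omega_n^{hk}$ (zero if $C=\emptyset$). For $n$ odd the eigenvalues of $P$ are: $\widetilde\mu_1=1$, $\widetilde\mu_2=(s_1-s_2)/d$; for $1\le h\le m$ with $\eta_h(S_2)=0$, $\mu_h=\eta_h(S_1)/d$; for $1\le h\le m$ with $\eta_h(S_2)\ne0$, $\mu_h^{(1)}=\frac1d\left(\eta_h(S_1)+\sqrt{\eta_h(S_2)\eta_h(S_2^{-1})}\right)$ and $\mu_h^{(2)}=\frac1d\left(\eta_h(S_1)-\sqrt{\eta_h(S_2)\eta_h(S_2^{-1})}\right)$, where the radicand is $|\eta_h(S_2)|^2$ and the non-negative root is taken. When $\eta_h(S_2)\ne0$, $\ell_h=\sqrt{\eta_h(S_2^{-1})/\eta_h(S_2)}$, with the square root chosen so that $\ell_h\,\eta_h(S_2)=\sqrt{\eta_h(S_2)\eta_h(S_2^{-1})}$. *)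

(* Defs.v *)
From mathcomp Require Import all_boot all_order all_algebra.
From mathcomp Require Import all_fingroup all_solvable.
From mathcomp Require Import reals trigo complex.

Set Implicit Arguments.
Unset Strict Implicit.
Unset Printing Implicit Defensive.

Import Order.TTheory GRing.Theory Num.Theory.

Local Open Scope ring_scope.
Local Open Scope sesquilinear_scope.

Definition exactly_one (P Q : Prop) : Prop := (P /\ ~ Q) \/ (~ P /\ Q).

Fixpoint chebyshevT (C : comNzRingType) (k : nat) : {poly C} :=
  match k with
  | 0%N => 1
  | k'.+1 => match k' with
             | 0%N => 'X
             | k''.+1 => 2%:R * 'X * chebyshevT C k' - chebyshevT C k''
             end
  end.

(* A graph is an adjacency relation [e] on a finite type [V]; it is meant to be
   symmetric and irreflexive. Rows and columns of the matrices below are indexed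
   by vertices and arcs through the enumerations of these finite types. *)

Definition graph_arc (V : finType) (e : rel V) : finType := {p : V * V | e p.1 p.2}.

Definition arc_head (V : finType) (e : rel V) (p : graph_arc e) : V := (val p).2.

Definition degree (V : finType) (e : rel V) (u : V) : nat := #|e u|.

Definition shift_mx (C : numClosedFieldType) (V : finType) (e : rel V)
    : 'M[C]_#|graph_arc e| :=
  \matrix_(i, j)
    (val (enum_val i) == ((val (enum_val j)).2, (val (enum_val j)).1))%:R.

Definition boundary_mx (C : numClosedFieldType) (V : finType) (e : rel V)
    : 'M[C]_(#|V|, #|graph_arc e|) :=
  \matrix_(i, j)
    if arc_head (enum_val j) == enum_val i
    then 1 / sqrtC (degree e (enum_val i))%:R else 0.

Definition grover_mx (C : numClosedFieldType) (V : finType) (e : rel V)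
    : 'M[C]_#|graph_arc e| :=
  let N := boundary_mx C e in
  shift_mx C e *m (2%:R *: (N ^t* *m N) - 1%:M).

Definition vertex_state (C : numClosedFieldType) (V : finType) (e : rel V)
    (u : V) : 'cV[C]_#|graph_arc e| :=
  (boundary_mx C e) ^t* *m delta_mx (enum_rank u) 0.

Definition PST (C : numClosedFieldType) (V : finType) (e : rel V)
    (u v : V) (tau : nat) : Prop :=
  [/\ u != v, (0 < tau)%N &
      exists gamma : C, `|gamma| = 1 /\
        grover_mx C e ^+ tau *m vertex_state C e u
          = gamma *: vertex_state C e v].

Definition cayley (gT : finGroupType) (S : {set gT}) : rel gT :=
  fun x y => (x * y^-1)%g \in S.

Definition normal_connection (gT : finGroupType) (S : {set gT}) : Prop :=
  exists B : {set {set gT}}, B \subset classes [set: gT] /\ S = cover B.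

Definition dihedral_pair (gT : finGroupType) (n : nat) (a b : gT) : Prop :=
  [/\ <<[set a; b]>>%g = [set: gT], (a ^+ n = 1)%g, (b ^+ 2 = 1)%g
    & (b * a * b = a^-1)%g].

Definition vertex_of_label (gT : finGroupType) (n : nat) (a b : gT) (u : nat)
    : gT :=
  (if (u < n)%N then a ^+ u else b * a ^+ (u - n)%N)%g.

Definition omega (R : realType) (n : nat) : R[i] :=
  Complex (cos (2%:R * pi / n%:R)) (sin (2%:R * pi / n%:R)).

Definition eta (R : realType) (gT : finGroupType) (n : nat) (a : gT)
    (h : nat) (X : {set gT}) : R[i] :=
  \sum_(k < n | (a ^+ k)%g \in X) omega R n ^+ (h * k).

Definition conn1 (gT : finGroupType) (a : gT) (S : {set gT}) : {set gT} :=
  S :&: <[a]>%g.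

Definition conn2 (gT : finGroupType) (a b : gT) (S : {set gT}) : {set gT} :=
  (b *: S)%g :&: <[a]>%g.

(* For odd [n], the numbers [mut1], [mut2], [mu], [mu1], [mu2] below are the
   eigenvalues of the discriminant N R N^* of the Cayley graph of [S]; [mu]
   is used when [eta h (conn2 a b S) = 0], [mu1] and [mu2] otherwise. *)

Definition mut1 (R : realType) : R[i] := 1.

Definition mut2 (R : realType) (gT : finGroupType) (a b : gT) (S : {set gT})
    : R[i] :=
  (#|conn1 a S|%:R - #|conn2 a b S|%:R) / #|S|%:R.

Definition mu (R : realType) (gT : finGroupType) (n : nat) (a : gT)
    (S : {set gT}) (h : nat) : R[i] :=
  eta R n a h (conn1 a S) / #|S|%:R.

(* The radicand is |eta h (conn2 a b S)|^2, and [sqrtC] of a non-negative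
   number is its non-negative root. *)
Definition eta_root (R : realType) (gT : finGroupType) (n : nat) (a b : gT)
    (S : {set gT}) (h : nat) : R[i] :=
  sqrtC (eta R n a h (conn2 a b S) * eta R n a h (conn2 a b S)^-1%g).

Definition mu1 (R : realType) (gT : finGroupType) (n : nat) (a b : gT)
    (S : {set gT}) (h : nat) : R[i] :=
  (eta R n a h (conn1 a S) + eta_root R n a b S h) / #|S|%:R.

Definition mu2 (R : realType) (gT : finGroupType) (n : nat) (a b : gT)
    (S : {set gT}) (h : nat) : R[i] :=
  (eta R n a h (conn1 a S) - eta_root R n a b S h) / #|S|%:R.

(* Of the two square roots of the quotient, the one whose product with
   [eta h (conn2 a b S)] is [eta_root]. *)
Definition ell (R : realType) (gT : finGroupType) (n : nat) (a b : gT)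
    (S : {set gT}) (h : nat) : R[i] :=
  let r := sqrtC (eta R n a h (conn2 a b S)^-1%g / eta R n a h (conn2 a b S)) in
  if r * eta R n a h (conn2 a b S) == eta_root R n a b S h then r else - r.

(* Main.v *)
Require Import Defs.
From mathcomp Require Import all_boot all_order all_algebra.
From mathcomp Require Import all_fingroup all_solvable.
From mathcomp Require Import reals trigo complex.
From mathcomp Require Import ring lra zify.

(** Why the theorem is true.

    For the Grover matrix U and the boundary matrix N of any graph without
    isolated vertices, the sequence N U^k N^* satisfies the Chebyshev
    recurrence in the discriminant P, so it equals T_k(P); as U is unitary and
    N^* isometric, PST from x to y at time tau means T_tau(P) e_x = gamma e_y
    with |gamma| = 1 ([PST_discriminant]). Pairing with a row eigenvector f
    of P for mu turns this into gamma f(y) = T_tau(mu) f(x), and the constant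
    vector forces gamma = 1.

    For a Cayley graph on the dihedral group the row eigenvectors are waves:
    X w^(hk) at the rotation a^k and Y w^(hk) at the reflection b a^k, where
    w is the primitive n-th root of unity. The sum over S acts on (X, Y) by the
    Hermitian matrix with diagonal entries alpha = eta_h(S_1) and off-diagonal
    entries beta = eta_h(S_2) and its conjugate ([wave_shift_sum]), which has
    the eigenvectors (beta, r) and (beta, -r) for alpha + r and alpha - r, with
    r = |beta|. All eigenvalues are real, hence so are all the T_tau(mu).

    - u and v on the same side. The eigenvalue with h = 1 makes w^(v - u) real,
      and as n is odd this gives u = v; so there is no PST
      ([PST_changes_side]).

    - u and v on different sides. If beta = 0 then (1, 0) and (0, 1) are both
      eigenvectors, and one of them vanishes at exactly one of the two vertices:
      so beta is never 0. Then the waves (beta, r) and (beta, -r) give exactly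
      the equations in (B) ([PST_crossP]), the index n - h giving the conjugate
      of the equations for h. The reflection symmetry of S_2 follows because
      the number l_h w^(|v-u| h) equals a real number: multiplied out, this
      says eta_h(S_2) = w^(2 |v-u| h) eta_h(S_2^-1) for all h, and Fourier
      inversion applies.

    It remains to see that (A) never holds ([alternating_impossible]). Its
    equations would make T_tau(P) act on each wave supported on rotations by
    (-1)^h for |h| <= m, so its entry between 1 and a, times n, would be the
    Dirichlet kernel at -w. Summing that kernel in closed form gives
    +-2 / (z + 1/z) with z = w^(m+1), a square root of w. But P is rational, so
    z + 1/z = 2 cos(theta) is rational, while n theta is a multiple of 2 pi:
    by Niven's argument z^3 = 1 ([niven_odd]), so n = 3. Of the non-normal S
    in the dihedral group of order 6, none satisfies the equations
    ([triangle_impossible]). *)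

Set Implicit Arguments.
Unset Strict Implicit.
Unset Printing Implicit Defensive.

Import Order.TTheory GRing.Theory Num.Theory.

Local Open Scope ring_scope.
Local Open Scope sesquilinear_scope.

(** * Chebyshev polynomials at rational points *)

Lemma chebyshevTSS (C : comNzRingType) k :
  chebyshevT C k.+2 = 2%:R * 'X * chebyshevT C k.+1 - chebyshevT C k.
Proof. by []. Qed.

Lemma chebyshevT_horner0 (C : comNzRingType) (x : C) :
  (chebyshevT C 0).[x] = 1.
Proof. exact: hornerC. Qed.

Lemma chebyshevT_horner1 (C : comNzRingType) (x : C) :
  (chebyshevT C 1).[x] = x.
Proof. exact: hornerX. Qed.

Lemma chebyshevT_hornerSS (C : comNzRingType) k (x : C) :
  (chebyshevT C k.+2).[x] =
    2%:R * x * (chebyshevT C k.+1).[x] - (chebyshevT C k).[x].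
Proof.
by rewrite chebyshevTSS hornerD hornerN !hornerM hornerX -polyC_natr hornerC.
Qed.

Lemma two_step_ind (P : nat -> Prop) :
  P 0%N -> P 1%N -> (forall k, P k -> P k.+1 -> P k.+2) -> forall k, P k.
Proof.
move=> P0 P1 PSS k; suff [] : P k /\ P k.+1 by [].
by elim: k => [|k [Pk PSk]]; split=> //; apply: PSS.
Qed.

Lemma rmorph_chebyshevT (C D : comNzRingType) (f : {rmorphism C -> D}) k x :
  f (chebyshevT C k).[x] = (chebyshevT D k).[f x].
Proof.
elim/two_step_ind: k => [||k IH0 IH1].
- by rewrite !chebyshevT_horner0 rmorph1.
- by rewrite !chebyshevT_horner1.
by rewrite !chebyshevT_hornerSS rmorphB !rmorphM rmorph_nat IH0 IH1.
Qed.

Lemma chebyshevT_at1 (C : comNzRingType) k : (chebyshevT C k).[1] = 1.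
Proof.
elim/two_step_ind: k => [||k IH0 IH1].
- exact: chebyshevT_horner0.
- exact: chebyshevT_horner1.
rewrite chebyshevT_hornerSS IH0 IH1; ring.
Qed.

Lemma chebyshevT_opp (C : comNzRingType) k (x : C) :
  (chebyshevT C k).[- x] = (-1) ^+ k * (chebyshevT C k).[x].
Proof.
elim/two_step_ind: k => [||k IH0 IH1].
- by rewrite !chebyshevT_horner0 mul1r.
- by rewrite !chebyshevT_horner1 mulN1r.
by rewrite !chebyshevT_hornerSS IH0 IH1 !exprS; ring.
Qed.

Lemma chebyshevT_joukowski (F : numFieldType) k (z : F) : z != 0 ->
  (chebyshevT F k).[(z + z^-1) / 2] = (z ^+ k + z^-1 ^+ k) / 2.
Proof.
move=> z0; elim/two_step_ind: k => [||k IH0 IH1].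
- by rewrite chebyshevT_horner0 !expr0; field.
- by rewrite chebyshevT_horner1 !expr1.
by rewrite chebyshevT_hornerSS IH0 IH1 !exprS; field.
Qed.

(** Write x = p / q in lowest terms. The integers 2 T_j(x / 2) q^j are
    congruent to p^j modulo q, by the recurrence for the monic polynomials
    2 T_j(X / 2). If T_k(x / 2) = 1 then q divides 2 q^k, hence p^k, so q = 1. *)
Lemma chebyshevT_rat_int k (x : rat) : (0 < k)%N ->
  (chebyshevT rat k).[x / 2] = 1 -> x \is a Num.int.
Proof.
move=> k0.
pose p := numq x; pose q := denq x.
have xE : x = p%:~R / q%:~R by rewrite /p /q divq_num_den.
have q0 : (q%:~R : rat) != 0 by rewrite intr_eq0 denq_neq0.
pose t j := 2 * (chebyshevT rat j).[x / 2] * q%:~R ^+ j.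
have rec j : t j.+2 = p%:~R * t j.+1 - q%:~R ^+ 2 * t j.
  by rewrite /t chebyshevT_hornerSS xE !exprS; field.
have cong j : exists A B c : int,
    [/\ t j = A%:~R, t j.+1 = B%:~R & B = p ^+ j.+1 + c * q].
  elim: j => [|j [A [B [c [tA tB BE]]]]].
    exists 2, p, 0; split.
    - by rewrite /t chebyshevT_horner0 expr0 !mulr1.
    - by rewrite /t chebyshevT_horner1 expr1 [in LHS]xE; field.
    - by rewrite mul0r addr0 expr1.
  exists B, (p * B - q ^+ 2 * A), (p * c - q * A); split=> //.
    by rewrite rec tA tB rmorphB !rmorphM.
  rewrite BE !exprS; ring.
move=> Tk.
have [_ [B [c [_ tB BE]]]] := cong k.-1.
rewrite prednK // in tB BE.
have qB : B = 2 * q ^+ k.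
  by apply: (@intr_inj rat); rewrite -tB /t Tk mulr1 rmorphM rmorphXn.
have qp : (q %| p ^+ k)%Z.
  have -> : p ^+ k = (2 * q ^+ k.-1 - c) * q.
    rewrite mulrBl -mulrA -exprSr prednK // -qB BE; ring.
  exact: dvdz_mull.
have q1 : q = 1.
  have cop : coprimez q (p ^+ k).
    by rewrite coprimez_sym; apply: coprimezXl; rewrite /coprimez /gcdz;
       have := coprime_num_den x; rewrite /coprime => /eqP ->.
  have : (q %| 1)%Z.
    by rewrite -(Gauss_dvdzl 1 cop) mul1r.
  by rewrite dvdz1 => /eqP; have := denq_gt0 x; rewrite -/q; lia.
by rewrite Qint_def; apply/eqP.
Qed.

Lemma int_of_chebyshevT_rat (F : numFieldType) k (x : rat) : (0 < k)%N ->
  (chebyshevT F k).[ratr x / 2] = 1 -> exists z : int, ratr x = z%:~R :> F.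
Proof.
move=> k0 Tk.
have /intrP [z ->] : x \is a Num.int; last by exists z; rewrite ratr_int.
apply: (chebyshevT_rat_int k0); apply: (fmorph_inj (@ratr F)).
by rewrite rmorph_chebyshevT rmorph1 /= fmorph_div /= ratr_nat.
Qed.

(** * Chebyshev recurrence for the Grover walk *)

(** The value of T_k at a square matrix, by the recurrence: matrices of an
    arbitrary size p, which may be 0, need not form a nontrivial ring in which
    to evaluate a polynomial. *)
Fixpoint chebyshev_mx (C : comNzRingType) p (P : 'M[C]_p) (k : nat) : 'M[C]_p :=
  match k with
  | 0%N => 1%:M
  | k'.+1 => match k' with
             | 0%N => P
             | k''.+1 => 2%:R *: (chebyshev_mx P k' *m P) - chebyshev_mx P k''
             end
  end.

Lemma chebyshev_mxSS (C : comNzRingType) p (P : 'M[C]_p) k :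
  chebyshev_mx P k.+2 = 2%:R *: (chebyshev_mx P k.+1 *m P) - chebyshev_mx P k.
Proof. by []. Qed.

Lemma map_chebyshev_mx (C D : comNzRingType) (f : {rmorphism C -> D}) p
    (P : 'M[C]_p) k :
  map_mx f (chebyshev_mx P k) = chebyshev_mx (map_mx f P) k.
Proof.
elim/two_step_ind: k => [||k IH0 IH1] //; first by rewrite /= map_mx1.
by rewrite !chebyshev_mxSS map_mxB map_mxZ map_mxM IH0 IH1 rmorph_nat.
Qed.

Lemma chebyshev_mx_eigen (C : comNzRingType) p (P : 'M[C]_p) (mu : C)
    (f : 'rV[C]_p) k :
  f *m P = mu *: f -> f *m chebyshev_mx P k = (chebyshevT C k).[mu] *: f.
Proof.
move=> fP; elim/two_step_ind: k => [||k IH0 IH1].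
- by rewrite mulmx1 chebyshevT_horner0 scale1r.
- by rewrite chebyshevT_horner1.
rewrite chebyshev_mxSS mulmxBr -scalemxAr mulmxA IH1 IH0 -scalemxAl fP.
by rewrite !scalerA -scalerBl chebyshevT_hornerSS mulrAC.
Qed.

Section GroverWalk.

Variables (C : numClosedFieldType) (V : finType) (e : rel V).
Hypotheses (e_sym : symmetric e) (e_deg : forall x, (0 < degree e x)%N).

Let N := boundary_mx C e.
Let Sh := shift_mx C e.

Definition discriminant : 'M[C]_#|V| := N *m Sh *m N ^t*.

Lemma sum_arc (F : V * V -> C) :
  \sum_(j < #|graph_arc e|) F (val (enum_val j))
    = \sum_x \sum_(y | e x y) F (x, y).
Proof.
transitivity (\sum_(a : graph_arc e) F (val a)).
  by rewrite [RHS](reindex _ (onW_bij _ (enum_val_bij (graph_arc e)))).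
rewrite pair_big_dep /= -(big_sub [pred p : V * V | e p.1 p.2] F).
by apply: eq_bigr; case.
Qed.

Lemma boundary_mx_real : N ^t* = N^T.
Proof.
apply/matrixP=> j i; rewrite !mxE; case: ifP => _; last by rewrite conjC0.
by apply: conj_Creal; rewrite ger0_real // divr_ge0 ?sqrtC_ge0 ?ler01 ?ler0n.
Qed.

Lemma boundary_mxK : N *m N ^t* = 1%:M.
Proof.
rewrite boundary_mx_real; apply/matrixP=> i k; rewrite !mxE.
pose w (x : V) : C := 1 / sqrtC (degree e x)%:R.
pose F (p : V * V) : C := if p.2 == enum_val i then
   (if p.2 == enum_val k then w (enum_val i) * w (enum_val k) else 0) else 0.
transitivity (\sum_(j < #|graph_arc e|) F (val (enum_val j))).
  apply: eq_bigr => j _; rewrite !mxE /F /arc_head /w.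
  by case: ifP => _; rewrite ?mul0r //; case: ifP; rewrite ?mulr0.
rewrite sum_arc (eq_bigr (fun x => if e x (enum_val i) then
  (if i == k then w (enum_val i) ^+ 2 else 0) else 0)); last first.
  move=> x _; case: ifPn => ex.
    rewrite (bigD1 (enum_val i)) //= big1 ?addr0.
      by rewrite /F /= eqxx (inj_eq enum_val_inj); case: eqP => // ->.
    by move=> y /andP [_ /negPf yi]; rewrite /F /= yi.
  rewrite big1 // => y exy; rewrite /F /=; case: eqP => // yi.
  by rewrite yi (negPf ex) in exy.
rewrite -big_mkcond /= sumr_const.
rewrite (_ : #|e^~ (enum_val i)| = degree e (enum_val i)); last first.
  by apply: eq_card => x; rewrite -!topredE /= e_sym.
case: eqP => _; last by rewrite mul0rn.
rewrite /w expr_div_n sqrtCK expr1n div1r -[LHS]mulr_natr mulVf //.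
by rewrite pnatr_eq0 -lt0n.
Qed.

Lemma shift_mx_sym : Sh^T = Sh.
Proof.
apply/matrixP=> i j; rewrite !mxE.
case: (val (enum_val i)) => a b; case: (val (enum_val j)) => c d /=.
by rewrite !xpair_eqE (eq_sym c) (eq_sym d) andbC.
Qed.

Lemma shift_mx_real : Sh ^t* = Sh.
Proof.
by rewrite shift_mx_sym; apply/matrixP=> i j; rewrite !mxE conjC_nat.
Qed.

(** Multiplying by the shift matrix reads a column, given as a function of the
    arc, at the reversed arc. *)
Lemma shift_mx_row q (M : 'M[C]_(#|graph_arc e|, q)) (G : V * V -> C) i k :
    (forall j, M j k = G (val (enum_val j))) ->
  (Sh *m M) i k = G ((val (enum_val i)).2, (val (enum_val i)).1).
Proof.
move=> MG; rewrite mxE.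
case Ei : (enum_val i) => [[x y] exy] /=.
have eyx : e y x by rewrite e_sym.
pose a : graph_arc e := exist (fun p : V * V => e p.1 p.2) (y, x) eyx.
rewrite (bigD1 (enum_rank a)) //= big1 ?addr0.
  by rewrite !mxE MG enum_rankK Ei /= eqxx mul1r.
move=> j ja; rewrite !mxE Ei /=; case: eqP => [[xj yj]|_]; last by rewrite mul0r.
case/eqP: ja; apply: enum_val_inj; rewrite enum_rankK; apply: val_inj => /=.
by rewrite xj yj; case: (val _).
Qed.

Lemma shift_mxK : Sh *m Sh = 1%:M.
Proof.
apply/matrixP => i k.
rewrite (@shift_mx_row _ _
  (fun p => (p == ((val (enum_val k)).2, (val (enum_val k)).1))%:R)).
  rewrite !mxE -(inj_eq enum_val_inj) -(inj_eq val_inj).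
  case: (val (enum_val i)) => a b; case: (val (enum_val k)) => c d /=.
  by rewrite !xpair_eqE andbC.
by move=> j; rewrite !mxE.
Qed.

Let U := grover_mx C e.

Lemma grover_mxE : U = Sh *m (2%:R *: (N ^t* *m N) - 1%:M).
Proof. by []. Qed.

Lemma adj_mul p q r (A : 'M[C]_(p, q)) (B : 'M[C]_(q, r)) :
  (A *m B) ^t* = B ^t* *m A ^t*.
Proof. by rewrite trmx_mul map_mxM. Qed.

Lemma grover_mx_unitary : U ^t* *m U = 1%:M.
Proof.
have QQ : (N ^t* *m N) *m (N ^t* *m N) = N ^t* *m N.
  by rewrite mulmxA -(mulmxA _ N) boundary_mxK mulmx1.
have Qa : (2%:R *: (N ^t* *m N) - 1%:M) ^t* = 2%:R *: (N ^t* *m N) - 1%:M.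
  rewrite linearB /= linearZ /= trmx1 map_mxB map_mxZ map_mx1 adj_mul trmxCK.
  by rewrite rmorph_nat.
rewrite grover_mxE adj_mul Qa shift_mx_real mulmxA -(mulmxA _ Sh Sh) shift_mxK.
rewrite mulmx1 mulmxBl !mulmxBr mulmx1 mul1mx -!scalemxAl -!scalemxAr QQ.
rewrite mulmx1; set Q := N ^t* *m N.
by rewrite !scaler_nat [X in X - _ - _]mulr2n addrK subKr.
Qed.

(** The reflection 2 N^* N - 1 fixes the image of N^*, so U N^* = R N^* and
    U U N^* = 2 U N^* P - N^* : multiplying by N U^k on the left gives the
    Chebyshev recurrence. *)
Lemma grover_walk_chebyshev k : N *m U ^+ k *m N ^t* = chebyshev_mx discriminant k.
Proof.
have UN : U *m N ^t* = Sh *m N ^t*.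
  rewrite grover_mxE -mulmxA mulmxBl -scalemxAl -mulmxA boundary_mxK mulmx1.
  by rewrite mul1mx scaler_nat mulr2n addrK.
have UUN : U *m (U *m N ^t*) = 2%:R *: (U *m N ^t* *m discriminant) - N ^t*.
  rewrite UN {1}grover_mxE -mulmxA mulmxBl -scalemxAl mul1mx mulmxBr -scalemxAr.
  by rewrite /discriminant !mulmxA shift_mxK mul1mx.
(* rewriting up to conversion would otherwise unfold U *)
move: UN UUN; generalize U => W UN UUN.
elim/two_step_ind: k => [||k IH0 IH1].
- by rewrite expr0 mulmx1 boundary_mxK.
- by rewrite expr1 -mulmxA UN mulmxA.
rewrite chebyshev_mxSS -IH0 -IH1 !exprSr -!mulmxE -!mulmxA UUN.
by rewrite !mulmxBr -!scalemxAr !mulmxA.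
Qed.

(** One direction applies N. Conversely, if w = U^tau Phi_x has N w = gamma e_y,
    then w and gamma Phi_y are unit vectors with inner product 1, so they are
    equal. *)
Lemma PST_discriminant x y tau :
  PST C e x y tau <->
  [/\ x != y, (0 < tau)%N & exists gamma : C, `|gamma| = 1 /\
    chebyshev_mx discriminant tau *m delta_mx (enum_rank x) (0 : 'I_1)
      = gamma *: delta_mx (enum_rank y) 0].
Proof.
rewrite /PST -/U /vertex_state -/N; split=> -[xy tau0 [g [g1 H]]]; split=> //;
  exists g; split=> //.
  rewrite -grover_walk_chebyshev -!mulmxA H -scalemxAr mulmxA boundary_mxK.
  by rewrite mul1mx.
set ex : 'cV[C]_#|V| := delta_mx _ _ in H *.
set ey : 'cV[C]_#|V| := delta_mx _ _ in H *.
set w := U ^+ tau *m _.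
have deltaK z : ((delta_mx z 0 : 'cV[C]_#|V|) ^t*) *m delta_mx z 0 = 1%:M.
  rewrite trmx_delta map_delta_mx mul_delta_mx.
  by apply/matrixP=> i j; rewrite !mxE !ord1.
have Uk k : (U ^+ k) ^t* *m U ^+ k = 1%:M.
  elim: k => [|k IH]; first by rewrite expr0 trmx1 map_mx1 mulmx1.
  rewrite exprS -mulmxE adj_mul -mulmxA (mulmxA _ U) grover_mx_unitary mul1mx.
  exact: IH.
have Nw : N *m w = g *: ey by rewrite -H -grover_walk_chebyshev -!mulmxA.
have ww : w ^t* *m w = 1%:M.
  rewrite /w adj_mul -mulmxA (mulmxA _ (U ^+ tau)) Uk mul1mx adj_mul trmxCK.
  by rewrite -mulmxA (mulmxA N) boundary_mxK mul1mx deltaK.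
(* d is the difference of the two vectors; its squared norm is computed below *)
clearbody w; pose d := w - g *: (N ^t* *m ey).
suff dd : d ^t* *m d = 0.
  apply/eqP; rewrite -subr_eq0 -/d; apply/eqP/colP => i.
  have := congr1 (fun M : 'M[C]_1 => M 0 0) dd; rewrite !mxE => /eqP.
  rewrite psumr_eq0 => [/allP /(_ i)|j _]; last first.
    by rewrite !mxE -normCKC exprn_ge0.
  rewrite mem_index_enum => /(_ isT) /=; rewrite !mxE -normCKC.
  by rewrite expf_eq0 /= normr_eq0 => /eqP.
have gg : g^* * g = 1 by rewrite -normCKC g1 expr1n.
have adjB p q (A B : 'M[C]_(p, q)) : (A - B) ^t* = A ^t* - B ^t*.
  by rewrite [(A - B)^T]linearB /= map_mxB.
have adjZ p q (A : 'M[C]_(p, q)) a : (a *: A) ^t* = a^* *: A ^t*.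
  by rewrite [(a *: A)^T]linearZ /= map_mxZ.
rewrite /d adjB adjZ adj_mul trmxCK.
rewrite mulmxBl !mulmxBr ww -!scalemxAr -!scalemxAl -!mulmxA (mulmxA N) boundary_mxK Nw.
have wN : w ^t* *m (N ^t* *m ey) = g^* *: 1%:M.
  by rewrite mulmxA -adj_mul Nw adjZ -scalemxAl deltaK.
rewrite wN mul1mx -scalemxAr deltaK !scalerA gg (mulrC g) gg scale1r.
by rewrite !subrr.
Qed.

Lemma discriminant_regular d : (forall x, degree e x = d) ->
  discriminant = \matrix_(i, j) ((e (enum_val i) (enum_val j))%:R / d%:R).
Proof.
move=> deg_d; apply/matrixP=> i k.
have w2 : sqrtC (d%:R : C) * sqrtC d%:R = d%:R by rewrite -expr2 sqrtCK.
pose w : C := 1 / sqrtC d%:R.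
have NE (j : 'I_#|V|) a : N j a = if (val (enum_val a)).2 == enum_val j then w else 0.
  by rewrite mxE /arc_head deg_d.
rewrite /discriminant -mulmxA mxE boundary_mx_real.
pose F (p : V * V) : C := if p.2 == enum_val i then
   (if p.1 == enum_val k then w * w else 0) else 0.
transitivity (\sum_(a < #|graph_arc e|) F (val (enum_val a))).
  apply: eq_bigr => a _.
  rewrite NE (@shift_mx_row _ _ (fun p => if p.2 == enum_val k then w else 0)).
    by rewrite /F; case: ifP => _; rewrite ?mul0r //; case: ifP; rewrite ?mulr0.
  by move=> j; rewrite mxE NE.
rewrite sum_arc mxE (bigD1 (enum_val k)) //= [X in _ + X]big1 ?addr0; last first.
  move=> x /negPf xk; rewrite big1 // => y _; rewrite /F /= xk.
  by case: ifP.
rewrite (e_sym (enum_val i)).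
case: (boolP (e (enum_val k) (enum_val i))) => [eki|/negPf eki]; last first.
  rewrite mul0r big1 // => y; rewrite /F /=; case: eqP => // ->.
  by rewrite eki.
rewrite (bigD1 (enum_val i)) //= /F /= !eqxx big1 ?addr0.
  by rewrite /w mulf_div !mul1r w2.
by move=> y /andP [_ /negPf ->].
Qed.

End GroverWalk.

(** * Roots of unity and Niven's argument *)

Lemma omegaX (R : realType) n k :
  omega R n ^+ k = Complex (cos (2 * pi / n%:R *+ k)) (sin (2 * pi / n%:R *+ k)).
Proof.
elim: k => [|k IH]; first by rewrite expr0 mulr0n cos0 sin0.
rewrite exprS IH; apply/eqP; rewrite eq_complex /= [_ *+ k.+1]mulrS cosD sinD.
by rewrite eqxx /= addrC.
Qed.

Lemma omega_primitive (R : realType) n :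
  (0 < n)%N -> n.-primitive_root (omega R n).
Proof.
move=> n0; have nR : 0 < n%:R :> R by rewrite ltr0n.
apply/andP; split=> //; apply/forallP => i.
rewrite unity_rootE omegaX eq_complex /=; set k := i.+1.
(* halving the angle brings it into ]0, pi[, where sin is positive *)
have argE : 2 * pi / n%:R *+ k = (pi * k%:R / n%:R) *+ 2 :> R.
  by rewrite -[LHS]mulr_natr -[RHS]mulr_natr; field; rewrite gt_eqF.
rewrite argE; have [->|kn] := eqVneq k n.
  by rewrite mulfK ?(lt0r_neq0 nR) // cos2pi sin2pi !eqxx.
have kltn : (k < n)%N by rewrite ltn_neqAle kn ltn_ord.
apply/eqP/negbTE; rewrite negb_and; apply/orP; left.
have sin_pos : 0 < sin (pi * k%:R / n%:R : R).
  apply: sin_gt0_pi; rewrite divr_gt0 ?mulr_gt0 ?pi_gt0 ?ltr0n //=.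
  by rewrite ltr_pdivrMr // ltr_pM2l ?pi_gt0 // ltr_nat.
rewrite cos_mulr2n cos2sin2; apply/eqP => H.
have : sin (pi * k%:R / n%:R : R) ^+ 2 = 0 by lra.
by apply/eqP; rewrite expf_neq0 // gt_eqF.
Qed.

Lemma sum_eq_scale (A : comPzSemiRingType) (I : finType) (P : pred I)
    (F G : I -> A) c d :
  (forall i, P i -> F i = c * G i * d) ->
  \sum_(i | P i) F i = c * (\sum_(i | P i) G i) * d.
Proof. by move=> FG; rewrite (eq_bigr _ FG) -mulr_suml -mulr_sumr. Qed.

Lemma modn_double_inj n u v : odd n ->
  (2 * u = 2 * v %[mod n] -> u = v %[mod n])%N.
Proof.
move=> n_odd; wlog uv : u v / (u <= v)%N.
  by move=> W; case: (leqP u v) => [/W //|/ltnW /W vu e]; rewrite vu.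
move=> /eqP; rewrite eq_sym eqn_mod_dvd ?leq_mul2l // -mulnBr Gauss_dvdr.
  by move=> nvu; apply/eqP; rewrite eq_sym eqn_mod_dvd.
by rewrite coprimen2.
Qed.

(** z + 1/z is rational and twice a point where T_n takes the value 1, so it is
    an integer c with |c| <= 2. The values 1, 0 and -2 would make z^3, z^2 or z
    equal to -1, an element of even order; the values 2 and -1 give z^3 = 1. *)
Lemma niven_odd (F : numFieldType) (n : nat) (z : F) (y : rat) : odd n ->
  z ^+ n = 1 -> z + z^-1 = ratr y -> z ^+ 3 = 1.
Proof.
move=> n_odd zn zy; have n0 : (0 < n)%N by case: n n_odd {zn}.
have no_neg1 (x : F) : x ^+ n = 1 -> x <> -1.
  move=> xn xN1; move/eqP: xn; rewrite xN1 -signr_odd n_odd expr1.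
  by rewrite eq_sym -subr_eq0 opprK -mulr2n pnatr_eq0.
have z0 : z != 0.
  by apply/eqP=> z0; move/eqP: zn; rewrite z0 expr0n gtn_eqF // eq_sym oner_eq0.
have norm_z : `|z| = 1 by apply/eqP; rewrite -(pexpr_eq1 n0) // -normrX zn normr1.
(* ratr y / 2 is the cosine of z, and T_n takes the value 1 there *)
have [c yc] : exists c : int, ratr y = c%:~R :> F.
  apply: (int_of_chebyshevT_rat n0); rewrite -zy chebyshevT_joukowski //.
  by rewrite exprVn zn invr1; field.
have c2 : `|c| <= 2.
  rewrite -(ler_int F) intr_norm -yc -zy (le_trans (ler_normD _ _)) //.
  by rewrite normfV norm_z invr1.
have zq : z ^+ 2 = c%:~R * z - 1.
  by rewrite -yc -zy; field.
have pow_n k : (z ^+ k) ^+ n = 1 by rewrite exprAC zn expr1n.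
have : [\/ c = 2, c = 1 | c = 0] \/ c = -1 \/ c = -2.
  have [->|[->|[->|[->|->]]]] : c = 2 \/ c = 1 \/ c = 0 \/ c = -1 \/ c = -2.
  - by lia.
  - by left; constructor 1.
  - by left; constructor 2.
  - by left; constructor 3.
  - by right; left.
  by right; right.
case=> [[]|[]] cE; move: zq; rewrite cE => zq.
- have /eqP : (z - 1) ^+ 2 = 0 by rewrite sqrrB zq; ring.
  by rewrite sqrf_eq0 subr_eq0 => /eqP ->; rewrite expr1n.
- by case: (no_neg1 _ (pow_n 3)); rewrite exprS zq mulrBr mulrCA -expr2 zq; ring.
- by case: (no_neg1 _ (pow_n 2)); rewrite zq; ring.
- by rewrite exprS zq mulrBr mulrCA -expr2 zq; ring.
have /eqP : (z + 1) ^+ 2 = 0 by rewrite sqrrD zq; ring.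
by rewrite sqrf_eq0 addr_eq0 => /eqP /(no_neg1 _ zn).
Qed.

Lemma dirichlet_kernel (F : fieldType) m (z : F) : z != 0 ->
  (1 + \sum_(1 <= h < m.+1) (z ^+ h + z ^- h)) * (1 - z) = z ^- m - z ^+ m.+1.
Proof.
move=> z0; elim: m => [|m IH].
  by rewrite big_geq // addr0 mul1r expr0 invr1 expr1.
rewrite big_nat_recr //= addrA mulrDl IH !exprS; field.
by rewrite z0 expf_neq0.
Qed.

(** The values at 1/2 have period 6; the even ones are 1, -1/2, -1/2. *)
Lemma chebyshevT_half_even (F : numFieldType) k :
  (chebyshevT F (2 * k)).[1 / 2] != -1.
Proof.
pose c j := (chebyshevT F j).[1 / 2].
have cSS j : c j.+2 = c j.+1 - c j by rewrite /c chebyshevT_hornerSS; field.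
have : [\/ c (2 * k)%N = 1 /\ c (2 * k).+1 = 1 / 2,
           c (2 * k)%N = - (1 / 2) /\ c (2 * k).+1 = -1
         | c (2 * k)%N = - (1 / 2) /\ c (2 * k).+1 = 1 / 2].
  elim: k => [|k IH].
    by constructor 1; rewrite /c chebyshevT_horner0 chebyshevT_horner1.
  rewrite mulnS !add2n !cSS.
  case: IH => -[-> ->]; [constructor 2|constructor 3|constructor 1];
    split; by field.
rewrite -/(c _) => c_val; apply/eqP=> cN1.
have one_neq : 1 <> - 1 :> F.
  by move/eqP; rewrite -subr_eq0 opprK -mulr2n pnatr_eq0.
have half_neq : - (1 / 2) <> - 1 :> F.
  have : 2 * - (1 / 2) + 2 = 1 :> F by field.
  by move=> + e; rewrite e mulrN1 addNr => /eqP; rewrite eq_sym oner_eq0.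
by case: c_val => -[e _]; move: cN1; rewrite e.
Qed.

(** * Waves on the dihedral group *)

Section Dihedral.
Variables (gT : finGroupType) (n : nat) (a b : gT).
Hypotheses (n_gt0 : (0 < n)%N) (hab : dihedral_pair n a b).
Hypothesis card_gT : #|[set: gT]| = (2 * n)%N.
Local Open Scope group_scope.

Let an : a ^+ n = 1. Proof. by case: hab. Qed.
Let bb : b * b = 1. Proof. by case: hab. Qed.
Let bV : b^-1 = b.
Proof. by apply/eqP; rewrite eq_sym eq_mulgV1 invgK bb. Qed.
Let bab : b * a * b = a^-1. Proof. by case: hab. Qed.

Lemma conj_rotation x : x \in <[a]> -> b * x * b = x^-1.
Proof.
case/cycleP=> k ->; rewrite -expVgn -bab.
elim: k => [|k IH]; first by rewrite !expg0 mulg1 bb.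
by rewrite !expgS -IH !mulgA -(mulgA (b * a) b b) bb mulg1.
Qed.

Lemma dihedral_prod : <[a]> * <[b]> = [set: gT].
Proof.
have [<- _ _ _] := hab.
have nab : <[b]> \subset 'N(<[a]>).
  rewrite cycle_subG inE; apply/subsetP=> _ /imsetP [x xa ->].
  by rewrite /conjg bV mulgA conj_rotation // groupV.
rewrite -norm_joinEr //; by rewrite joing_idl joing_idr.
Qed.

(** The 2n elements of <[a]> * <[b]> are at most #[a] * #[b], where #[a] <= n and
    #[b] <= 2, so both bounds are attained. *)
Lemma order_rotation : #[a] = n.
Proof.
have le_a : (#[a] <= n)%N by rewrite dvdn_leq // order_dvdn an.
have le_b : (#[b] <= 2)%N by rewrite dvdn_leq // order_dvdn expgS expg1 bb.
apply/eqP; rewrite eqn_leq le_a -(leq_pmul2l (isT : 0 < 2)%N) (mulnC _ #[a]).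
apply: leq_trans (leq_mul (leqnn _) le_b).
rewrite [leqRHS](mul_cardG <[a]> <[b]>) dihedral_prod card_gT.
by rewrite leq_pmulr // cardG_gt0.
Qed.

Lemma reflection_notin : b \notin <[a]>.
Proof.
apply/negP=> ba; have : <[a]> = [set: gT].
  rewrite -dihedral_prod; symmetry; apply: mulGSid.
  by rewrite cycle_subG.
move/(congr1 (fun A : {set gT} => #|A|)); rewrite -orderE order_rotation card_gT.
lia.
Qed.

Lemma reflection_mem x : (b * x \in <[a]>) = (x \notin <[a]>).
Proof.
have [xa|xNa] := boolP (x \in <[a]>).
  by rewrite groupMr // (negPf reflection_notin).
have : x^-1 \in <[a]> * <[b]> by rewrite dihedral_prod inE.
case/mulsgP=> y z ya zb xE.
have zE : z = b.
  move: zb; rewrite (_ : <[b]> = [set 1; b]); last first.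
    apply/setP=> t; rewrite !inE; apply/idP/idP => [/cycleP [k ->]|].
      rewrite -(odd_double_half k) -muln2 expgD mulnC expgM [b ^+ 2]bb expg1n mulg1.
      by case: (odd k); rewrite ?expg1 ?expg0 eqxx ?orbT.
    by case/orP=> /eqP ->; rewrite ?group1 ?cycle_id.
  rewrite !inE => /orP [/eqP z1|/eqP //].
  by move: xNa; rewrite -groupV xE z1 mulg1 ya.
have -> : x = b * y^-1 by rewrite -[x]invgK xE zE invMg bV.
by rewrite mulgA bb mul1g groupV.
Qed.

Local Close Scope group_scope.
Variable R : realType.
Notation w := (omega R n).
Notation C := (R[i]).

Let wn : w ^+ n = 1. Proof. exact: prim_expr_order (omega_primitive R n_gt0). Qed.

(** The h-th character of the rotation subgroup, extended by 0. The sum has at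
    most one term and avoids choosing a logarithm. *)
Definition rot_char h (x : gT) : C := \sum_(k < n | (a ^+ k)%g == x) w ^+ (h * k).
Notation chi := rot_char.

Lemma omega_expM k : w ^+ (n * k) = 1.
Proof. by rewrite exprM wn expr1n. Qed.

Lemma omega_exp_modn h k : w ^+ (h * (k %% n)) = w ^+ (h * k).
Proof.
rewrite [in RHS](divn_eq k n) mulnDr exprD mulnA (mulnC (h * _)%N) omega_expM.
by rewrite mul1r.
Qed.

Lemma omega_conj : w^* = w^-1.
Proof.
rewrite invC_norm; suff -> : `|w| = 1 by rewrite expr1n invr1 mul1r.
by apply/eqP; rewrite -(pexpr_eq1 n_gt0) // -normrX wn normr1.
Qed.

Lemma omega_neq0 : w != 0.
Proof.
apply/eqP=> w0; move: wn => /eqP.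
by rewrite w0 expr0n eqn0Ngt n_gt0 eq_sym oner_eq0.
Qed.

Lemma rot_charX h k : chi h (a ^+ k)%g = w ^+ (h * k).
Proof.
rewrite /chi (big_pred1 (Ordinal (ltn_pmod k n_gt0))) /= ?omega_exp_modn //.
move=> j; rewrite /= -[(a ^+ k)%g](expg_mod_order) order_rotation.
rewrite eq_expg_mod_order order_rotation modn_mod -val_eqE /=.
by rewrite modn_small.
Qed.

Lemma rot_char_out h x : x \notin <[a]>%g -> chi h x = 0.
Proof.
move=> xa; rewrite /chi big_pred0 // => k; apply/negbTE/eqP=> kx.
by move: xa; rewrite -kx mem_cycle.
Qed.

Lemma rot_charM h x y : y \in <[a]>%g -> chi h (x * y)%g = chi h x * chi h y.
Proof.
move=> ya; have [xa|xNa] := boolP (x \in <[a]>%g); last first.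
  by rewrite (rot_char_out h xNa) mul0r rot_char_out // groupMr.
case/cycleP: ya => k ->; case/cycleP: xa => j ->.
by rewrite -expgD !rot_charX mulnDr exprD.
Qed.

Lemma rot_char1 h : chi h 1%g = 1.
Proof. by rewrite -(expg0 a) rot_charX muln0. Qed.

Lemma rot_charV h x : chi h x^-1%g = (chi h x)^*.
Proof.
have [xa|xNa] := boolP (x \in <[a]>%g); last first.
  by rewrite !rot_char_out ?conjC0 // groupV.
case/cycleP: xa => k xE.
have wE : (w ^+ (h * k))^* = (w ^+ (h * k))^-1.
  by rewrite rmorphXn /= omega_conj exprVn.
rewrite xE rot_charX wE; apply: (mulfI (expf_neq0 (h * k) omega_neq0)).
rewrite divff ?expf_neq0 ?omega_neq0 // -rot_charX.
by rewrite -rot_charM ?groupV ?mem_cycle // mulgV rot_char1.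
Qed.

Lemma rot_char0 x : chi 0 x = (x \in <[a]>%g)%:R.
Proof.
have [/cycleP [k ->]|xNa] := boolP (x \in <[a]>%g); last by rewrite rot_char_out.
by rewrite rot_charX mul0n.
Qed.

Lemma rot_char_comp h x : (h <= n)%N -> chi (n - h) x = (chi h x)^*.
Proof.
move=> hn; rewrite /chi rmorph_sum; apply: eq_bigr => k _.
rewrite rmorphXn /= omega_conj exprVn.
apply: (mulIf (expf_neq0 (h * k) omega_neq0)).
by rewrite mulVf ?expf_neq0 ?omega_neq0 // -exprD -mulnDl subnK // omega_expM.
Qed.

Lemma sum_rot_char h (g : gT -> C) :
  \sum_x chi h x * g x = \sum_(k < n) w ^+ (h * k) * g (a ^+ k)%g.
Proof.
under eq_bigr do rewrite mulr_suml.
rewrite (exchange_big_dep xpredT) //=; apply: eq_bigr => k _.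
by rewrite (big_pred1 (a ^+ k)%g) // => x; rewrite /= eq_sym.
Qed.

Lemma eta_char h (X : {set gT}) : eta R n a h X = \sum_(x in X) chi h x.
Proof.
rewrite [RHS]big_mkcond /= (eq_bigr (fun x => chi h x * (x \in X)%:R)).
  rewrite (sum_rot_char h (fun x => (x \in X)%:R)) /eta big_mkcond.
  apply: eq_bigr => k _.
  by case: ifP; rewrite ?mulr1 ?mulr0.
by move=> x _; case: ifP; rewrite ?mulr1 ?mulr0.
Qed.

(** The polynomial with coefficients g 0, ..., g (n - 1) has the n distinct
    roots w^h. *)
Lemma fourier_inj (g : nat -> C) :
  (forall h, (h < n)%N -> \sum_(k < n) w ^+ (h * k) * g k = 0) ->
  forall k, (k < n)%N -> g k = 0.
Proof.
move=> g0 k kn; pose p := \poly_(i < n) g i.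
suff p0 : p = 0 by have := coef_poly n g k; rewrite -/p p0 coef0 kn.
apply: (@roots_geq_poly_eq0 _ p [seq w ^+ i | i <- iota 0 n]).
- apply/allP=> _ /mapP [h + ->]; rewrite mem_iota add0n => /andP [_ hn].
  rewrite rootE horner_poly -[X in _ == X](g0 h hn); apply/eqP/eq_bigr => i _.
  by rewrite mulrC exprM.
- rewrite map_inj_in_uniq ?iota_uniq // => i j.
  rewrite !mem_iota !add0n => /andP [_ ilt] /andP [_ jlt] /eqP.
  rewrite (eq_prim_root_expr (omega_primitive R n_gt0)) => /eqP.
  by rewrite !modn_small.
by rewrite size_map size_iota size_poly.
Qed.

Lemma eta_inv h (X : {set gT}) : eta R n a h X^-1%g = (eta R n a h X)^*.
Proof.
rewrite !eta_char rmorph_sum (reindex_inj invg_inj) /=.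
by apply: eq_big => [x|x _]; rewrite ?mem_invg ?invgK ?rot_charV.
Qed.

Lemma eta_comp h (X : {set gT}) : (h <= n)%N ->
  eta R n a (n - h) X = (eta R n a h X)^*.
Proof.
move=> hn; rewrite !eta_char rmorph_sum; apply: eq_bigr => x _.
exact: rot_char_comp.
Qed.

Lemma eta0 (X : {set gT}) : X \subset <[a]>%g -> eta R n a 0 X = #|X|%:R.
Proof.
move=> /subsetP Xa; rewrite eta_char (eq_bigr (fun=> 1)) ?sumr_const // => x xX.
by rewrite rot_char0 Xa.
Qed.

Variable S : {set gT}.
Hypothesis S_inv : S = (S^-1)%g.

Let alpha h := eta R n a h (conn1 a S).
Let beta h := eta R n a h (conn2 a b S).

Lemma eta_conn1 h : alpha h = \sum_(s in S) chi h s.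
Proof.
rewrite /alpha eta_char big_mkcond [RHS]big_mkcond; apply: eq_bigr => s _.
rewrite inE; case: (s \in S) => //=; case: ifPn => // sa.
by rewrite rot_char_out.
Qed.

Lemma eta_conn2 h : beta h = \sum_(s in S) chi h (b * s)%g.
Proof.
rewrite /beta eta_char (reindex_inj (mulgI b)) /= big_mkcond [RHS]big_mkcond.
apply: eq_bigr => s _; rewrite inE mem_lcoset mulKg.
case: (s \in S) => //=; case: ifPn => // sa.
by rewrite rot_char_out.
Qed.

Lemma eta_conn1_real h : (alpha h)^* = alpha h.
Proof.
rewrite eta_conn1 [in RHS]S_inv rmorph_sum [RHS](reindex_inj invg_inj) /=.
by apply: eq_big => [x|x _]; rewrite ?mem_invg ?invgK ?rot_charV.
Qed.

Lemma card_conn : #|S| = (#|conn1 a S| + #|conn2 a b S|)%N.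
Proof.
rewrite -(cardsID <[a]>%g S); congr (_ + _)%N.
rewrite -(card_lcoset (S :\: <[a]>%g) b); apply: eq_card => x.
rewrite inE !mem_lcoset inE.
rewrite (_ : (b^-1 * x)%g = (b * x)%g); last by rewrite bV.
by rewrite reflection_mem negbK andbC.
Qed.

Definition wave X Y h x : C := X * chi h x + Y * chi h (b * x)%g.

(** Both parts of a wave are characters on their coset, so translating by s
    multiplies by a character value of s, b s, s b or b s b. Summing over S
    turns these into alpha, beta and their conjugates, because S = S^-1 and
    conjugation by b inverts the rotations. *)
Lemma wave_shift_sum X Y h u :
  \sum_(s in S) wave X Y h (s * u)%g
    = wave (X * alpha h + Y * beta h) (X * (beta h)^* + Y * alpha h) h u.
Proof.
have [ua|uNa] := boolP (u \in <[a]>%g).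
  rewrite /wave (@rot_char_out h (b * u)%g) ?reflection_mem ?ua // mulr0 addr0.
  rewrite eta_conn1 eta_conn2 mulrDl big_split /=.
  by congr (_ + _); apply: sum_eq_scale => s _; rewrite ?mulgA rot_charM // mulrA.
have [v va ->] : exists2 v, v \in <[a]>%g & u = (b * v)%g.
  by exists (b * u)%g; rewrite ?reflection_mem // mulgA bb mul1g.
rewrite /wave (@rot_char_out h (b * v)%g) ?reflection_mem ?va // mulr0 add0r.
rewrite (mulgA b b) bb mul1g.
rewrite mulrDl big_split /= -(eta_conn1_real h) eta_conn1 eta_conn2.
rewrite !rmorph_sum /=; congr (_ + _); last first.
  apply: sum_eq_scale => s _; rewrite -mulrA; congr (_ * _).
  rewrite !mulgA rot_charM //; congr (_ * _).
  have [sa|sNa] := boolP (s \in <[a]>%g).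
    by rewrite conj_rotation // rot_charV.
  rewrite !rot_char_out ?conjC0 //.
  by rewrite -mulgA reflection_mem negbK -groupV invMg bV reflection_mem groupV.
rewrite [in LHS]S_inv (reindex_inj invg_inj) /=.
under eq_bigl => x do rewrite mem_invg invgK.
apply: sum_eq_scale => s _.
by rewrite mulgA rot_charM // mulrA -rot_charV invMg bV.
Qed.

(** * Eigenvectors of the discriminant and state transfer *)

Hypothesis S_neq0 : S != set0.

Notation d := (#|S|%:R : C).
Notation r h := (eta_root R n a b S h).

Lemma card_S_neq0 : d != 0.
Proof. by rewrite pnatr_eq0 cards_eq0. Qed.

Lemma cayley_sym : symmetric (cayley S).
Proof. by move=> x y; rewrite /cayley {1}S_inv mem_invg invMg invgK. Qed.

Lemma cayley_degree x : degree (cayley S) x = #|S|.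
Proof.
rewrite /degree -(card_imset (mem S) (mulIg x)).
apply: eq_card => y; rewrite -topredE /= cayley_sym /cayley.
apply/idP/imsetP => [yx|[s sS ->]]; last by rewrite mulgK.
by exists (y * x^-1)%g; rewrite ?mulgKV.
Qed.

(** (X, Y) is an eigenvector, for d mu, of the two-by-two matrix of
    [wave_shift_sum]. *)
Definition wave_mode h mu X Y :=
  X * alpha h + Y * beta h = d * mu * X
  /\ X * (beta h)^* + Y * alpha h = d * mu * Y.

Definition wave_row X Y h : 'rV[C]_#|gT| := \row_i wave X Y h (enum_val i).

Lemma wave_row_mul X Y h (q : 'cV[C]_#|gT|) :
  (wave_row X Y h *m q) 0 0
    = X * (\sum_(k < n) w ^+ (h * k) * q (enum_rank (a ^+ k)%g) 0)
      + Y * (\sum_(k < n) w ^+ (h * k) * q (enum_rank (b * a ^+ k)%g) 0).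
Proof.
transitivity (\sum_x wave X Y h x * q (enum_rank x) 0).
  rewrite mxE [RHS](reindex _ (onW_bij _ (enum_val_bij gT))) /=.
  by apply: eq_bigr => i _; rewrite mxE enum_valK.
under eq_bigr do rewrite mulrDl.
rewrite big_split /=; congr (_ + _).
  rewrite -(sum_rot_char h (fun x => q (enum_rank x) 0)) mulr_sumr.
  by apply: eq_bigr => x _; rewrite mulrA.
rewrite -(sum_rot_char h (fun x => q (enum_rank (b * x)%g) 0)) mulr_sumr.
rewrite (reindex_inj (mulgI b)) /=.
by apply: eq_bigr => x _; rewrite mulgA bb mul1g mulrA.
Qed.

Lemma wave_row_eigen h mu X Y : wave_mode h mu X Y ->
  wave_row X Y h *m discriminant C (cayley S) = mu *: wave_row X Y h.
Proof.
move=> [mX mY]; rewrite (discriminant_regular _ cayley_sym cayley_degree).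
apply/rowP=> j; rewrite !mxE; set u := enum_val j.
transitivity (\sum_x wave X Y h x * ((cayley S x u)%:R / d)).
  rewrite [RHS](reindex _ (onW_bij _ (enum_val_bij gT))) /=.
  by apply: eq_bigr => i _; rewrite !mxE.
rewrite (reindex_inj (mulIg u)) /=.
transitivity (d^-1 * \sum_(s in S) wave X Y h (s * u)%g).
  rewrite mulr_sumr [RHS]big_mkcond; apply: eq_bigr => s _.
  by rewrite /cayley mulgK; case: (s \in S); rewrite ?mul0r ?mulr0 ?mul1r // mulrC.
rewrite wave_shift_sum mX mY /wave.
by field; exact: card_S_neq0.
Qed.

Lemma eta_rootE h : r h = `|beta h|.
Proof. by rewrite /eta_root eta_inv normC_def. Qed.

Lemma wave_mode1 h : wave_mode h (mu1 R n a b S h) (beta h) (r h).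
Proof.
rewrite /wave_mode /mu1 -/(alpha h) eta_rootE -normCK; split.
  by field; exact: card_S_neq0.
by field; exact: card_S_neq0.
Qed.

Lemma wave_mode2 h : wave_mode h (mu2 R n a b S h) (beta h) (- r h).
Proof.
rewrite /wave_mode /mu2 -/(alpha h) eta_rootE -normCK; split.
  by field; exact: card_S_neq0.
by field; exact: card_S_neq0.
Qed.

Lemma wave_mode0 h X Y : beta h = 0 -> wave_mode h (mu R n a S h) X Y.
Proof.
move=> b0; rewrite /wave_mode /mu -/(alpha h) b0 conjC0; split.
  by field; exact: card_S_neq0.
by field; exact: card_S_neq0.
Qed.

Lemma wave_const x : wave 1 1 0 x = 1.
Proof.
by rewrite /wave !rot_char0 reflection_mem !mul1r; case: (x \in _); rewrite ?addr0 ?add0r.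
Qed.

Lemma wave_mode_const : wave_mode 0 1 1 1.
Proof.
rewrite /wave_mode /alpha /beta !eta0 ?subsetIr // conjC_nat !mul1r !mulr1.
by rewrite card_conn natrD addrC.
Qed.

(** As beta is nonzero, the waves (beta, r) and (beta, -r) span all waves with
    the same index, and by Fourier inversion on the two cosets the waves span all functions. *)
Lemma wave_span (q : 'cV[C]_#|gT|) :
  (forall h, (h < n)%N -> [/\ beta h != 0,
     wave_row (beta h) (r h) h *m q = 0
   & wave_row (beta h) (- r h) h *m q = 0]) ->
  q = 0.
Proof.
move=> modes.
pose A h := \sum_(k < n) w ^+ (h * k) * q (enum_rank (a ^+ k)%g) 0.
pose B h := \sum_(k < n) w ^+ (h * k) * q (enum_rank (b * a ^+ k)%g) 0.
have AB h : (h < n)%N -> A h = 0 /\ B h = 0.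
  move=> hn; have [b0 row1 row2] := modes h hn.
  have e1 : beta h * A h + r h * B h = 0 by rewrite -wave_row_mul row1 mxE.
  have e2 : beta h * A h = r h * B h.
    by apply/eqP; rewrite -subr_eq0 -mulNr -wave_row_mul row2 mxE.
  have r0 : r h != 0 by rewrite eta_rootE normr_eq0.
  have rB : r h * B h = 0.
    by move: e1; rewrite e2 -mulr2n => /eqP; rewrite mulrn_eq0 => /eqP.
  split; first by apply: (mulfI b0); rewrite e2 rB mulr0.
  by apply: (mulfI r0); rewrite rB mulr0.
apply/colP=> i; rewrite mxE -(enum_valK i); set x := enum_val i.
have xA z : z \in <[a]>%g -> exists2 k, (k < n)%N & z = (a ^+ k)%g.
  by case/cyclePmin=> k; rewrite order_rotation => kn ->; exists k.
have [/xA [k kn ->]|xNa] := boolP (x \in <[a]>%g).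
  apply: (@fourier_inj (fun k => q (enum_rank (a ^+ k)%g) 0)) kn => h hn.
  by have [] := AB h hn.
have /xA [k kn bx] : (b * x)%g \in <[a]>%g by rewrite reflection_mem.
have -> : x = (b * a ^+ k)%g by rewrite -bx mulgA bb mul1g.
apply: (@fourier_inj (fun k => q (enum_rank (b * a ^+ k)%g) 0)) kn => h hn.
by have [] := AB h hn.
Qed.

Variable tau : nat.
Hypothesis tau_gt0 : (0 < tau)%N.

Notation T := (chebyshev_mx (discriminant C (cayley S)) tau).
Notation t mu := ((chebyshevT C tau).[mu]).

Lemma wave_row_chebyshev h mu X Y : wave_mode h mu X Y ->
  wave_row X Y h *m T = t mu *: wave_row X Y h.
Proof. by move=> M; apply: chebyshev_mx_eigen; apply: wave_row_eigen. Qed.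

Lemma wave_row_delta X Y h z :
  (wave_row X Y h *m delta_mx (enum_rank z) (0 : 'I_1)) 0 0 = wave X Y h z.
Proof. by rewrite -colE !mxE enum_rankK. Qed.

Lemma PST_cayley x y :
  PST C (cayley S) x y tau <->
  x != y /\ exists gamma : C, `|gamma| = 1 /\
    T *m delta_mx (enum_rank x) (0 : 'I_1) = gamma *: delta_mx (enum_rank y) 0.
Proof.
have deg0 z : (0 < degree (cayley S) z)%N by rewrite cayley_degree card_gt0.
by rewrite (PST_discriminant C cayley_sym deg0); split=> [[]|[]].
Qed.

(** The phase gamma is 1 because the constant wave is a mode with mu = 1, at
    which every T_tau takes the value 1. *)
Lemma wave_of_PST x y : PST C (cayley S) x y tau ->
  forall h mu X Y, wave_mode h mu X Y -> wave X Y h y = t mu * wave X Y h x.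
Proof.
case/PST_cayley=> _ [g [g1 Tg]].
have key h mu X Y : wave_mode h mu X Y -> g * wave X Y h y = t mu * wave X Y h x.
  move=> M; rewrite -!wave_row_delta.
  have := congr1 (fun c : 'cV_#|gT| => (wave_row X Y h *m c) 0 0) Tg.
  by rewrite /= mulmxA (wave_row_chebyshev M) -scalemxAl -scalemxAr !mxE => ->.
have g_1 : g = 1.
  by have := key _ _ _ _ wave_mode_const; rewrite !wave_const chebyshevT_at1 !mulr1.
by move=> h mu X Y M; rewrite -(key _ _ _ _ M) g_1 mul1r.
Qed.

Lemma PST_of_wave x y : x != y ->
  (forall h, (h < n)%N -> [/\ beta h != 0,
    wave (beta h) (r h) h y = t (mu1 R n a b S h) * wave (beta h) (r h) h x
  & wave (beta h) (- r h) h y = t (mu2 R n a b S h) * wave (beta h) (- r h) h x]) ->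
  PST C (cayley S) x y tau.
Proof.
move=> xy H; apply/PST_cayley; split=> //.
exists 1; split; first exact: normr1.
have row0 h mu X Y : wave_mode h mu X Y -> wave X Y h y = t mu * wave X Y h x ->
    wave_row X Y h *m (T *m delta_mx (enum_rank x) 0 - delta_mx (enum_rank y) 0)
      = 0 :> 'M_1.
  move=> M e; apply/matrixP=> i j; rewrite !ord1 mulmxBr mulmxA.
  rewrite (wave_row_chebyshev M) -scalemxAl mxE [X in X + _]mxE [X in _ + X]mxE.
  by rewrite !wave_row_delta e subrr mxE.
apply/eqP; rewrite scale1r -subr_eq0; apply/eqP/wave_span => h hn.
have [b0 e1 e2] := H h hn.
by split; [|apply: row0 (wave_mode1 h) e1|apply: row0 (wave_mode2 h) e2].
Qed.

(** * Transfer within one side *)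

Notation vtx := (vertex_of_label n a b).

Lemma vertex_rotation k : (vtx k \in <[a]>%g) = (k < n)%N.
Proof.
rewrite /vertex_of_label; case: ifP => _; first by rewrite mem_cycle.
by rewrite reflection_mem mem_cycle.
Qed.

Lemma wave_vertex X Y h k :
  wave X Y h (vtx k) = (if (k < n)%N then X else Y) * w ^+ (h * k).
Proof.
rewrite /wave /vertex_of_label; case: ltnP => kn.
  by rewrite rot_charX rot_char_out ?mulr0 ?addr0 // reflection_mem mem_cycle.
rewrite rot_char_out ?reflection_mem ?mem_cycle // mulr0 add0r mulgA bb mul1g.
rewrite rot_charX; congr (_ * _).
by rewrite -[in RHS](subnK kn) mulnDr exprD (mulnC h n) omega_expM mulr1.
Qed.

Lemma chebyshev_conj mu : mu^* = mu -> (t mu)^* = t mu.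
Proof. by move=> mur; rewrite rmorph_chebyshevT /= mur. Qed.

Lemma eta_root_conj h : (r h)^* = r h.
Proof. by rewrite eta_rootE conj_Creal // normr_real. Qed.

Lemma mu_conj h : (mu R n a S h)^* = mu R n a S h.
Proof. by rewrite /mu fmorph_div /= eta_conn1_real conjC_nat. Qed.

Lemma mu1_conj h : (mu1 R n a b S h)^* = mu1 R n a b S h.
Proof.
by rewrite /mu1 fmorph_div /= rmorphD /= eta_conn1_real eta_root_conj conjC_nat.
Qed.

Lemma mu2_conj h : (mu2 R n a b S h)^* = mu2 R n a b S h.
Proof.
by rewrite /mu2 fmorph_div /= rmorphB /= eta_conn1_real eta_root_conj conjC_nat.
Qed.

Lemma real_wave_mode h : exists mu X Y,
  [/\ wave_mode h mu X Y, mu^* = mu, X != 0 & Y != 0].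
Proof.
have [b0|b0] := eqVneq (beta h) 0.
  exists (mu R n a S h), 1, 1; rewrite mu_conj oner_neq0; split=> //.
  exact: wave_mode0.
exists (mu1 R n a b S h), (beta h), (r h); rewrite mu1_conj; split=> //.
  exact: wave_mode1.
by rewrite eta_rootE normr_eq0.
Qed.

Lemma omega_exp_conj k : (w ^+ k)^* = (w ^+ k)^-1.
Proof. by rewrite rmorphXn /= omega_conj exprVn. Qed.

Lemma omega_exp_neq0 k : w ^+ k != 0.
Proof. by rewrite expf_neq0 // omega_neq0. Qed.

(** On one side both wave values carry the same amplitude, so a mode with h = 1
    gives w^v = t w^u with t real; conjugating, w^(2u) = w^(2v). *)
Lemma PST_changes_side u v : odd n -> (u < 2 * n)%N -> (v < 2 * n)%N ->
  PST C (cayley S) (vtx u) (vtx v) tau -> (u < n)%N != (v < n)%N.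
Proof.
move=> n_odd un vn pst; apply/negP=> /eqP side.
have [mu [X [Y [M mur X0 Y0]]]] := real_wave_mode 1.
have := wave_of_PST pst M; rewrite !wave_vertex side !mul1n.
set Z := if _ then X else Y; have Z0 : Z != 0 by rewrite /Z; case: ifP.
rewrite mulrCA => /(mulfI Z0) e.
have e' := congr1 (fun z : C => z^*) e; move: e'.
rewrite /= rmorphM /= (chebyshev_conj mur) !omega_exp_conj => e'.
have uv : w ^+ (2 * u) = w ^+ (2 * v).
  rewrite !mul2n -!addnn !exprD.
  have ne := omega_exp_neq0; have t_e : t mu = w ^+ u / w ^+ v.
    by apply: (mulIf (invr_neq0 (ne u))); rewrite -e' mulrAC divff // mul1r.
  by rewrite {1}e t_e -mulrA mulrCA; field; rewrite ?ne.
have /eqP := uv; rewrite (eq_prim_root_expr (omega_primitive R n_gt0)).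
move/eqP/(modn_double_inj n_odd) => uvn.
have uv_eq : u = v.
  case: (ltnP u n) side => un'; case: (ltnP v n) => // vn' _.
    by move: uvn; rewrite !modn_small.
  move: uvn; rewrite -(subnK un') -(subnK vn') !modnDr !modn_small; lia.
by case/PST_cayley: pst; rewrite uv_eq eqxx.
Qed.

(** * Transfer between a rotation and a reflection *)

Notation l h := (ell R n a b S h).

Lemma ell_mul h : beta h != 0 -> l h * beta h = r h.
Proof.
move=> b0; rewrite /ell -/(beta h) /=; set q := sqrtC _.
have [//|qb] := eqVneq; have : (q * beta h) ^+ 2 = r h ^+ 2.
  rewrite exprMn sqrtCK /eta_root sqrtCK -/(beta h).
  by rewrite expr2 mulrA divfK // mulrC.
by move/eqP; rewrite eqf_sqr (negPf qb) /= => /eqP qbN; rewrite mulNr qbN opprK.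
Qed.

(** Since the amplitudes satisfy |X|^2 = Y^2 and s is real, conjugation
    interchanges the roles of the two vertices; so it does not matter
    which of them is a rotation. *)
Lemma cross_wave_real X (Y s : C) (p q : C) : Y^* = Y -> s^* = s -> X != 0 ->
    X * X^* = Y ^+ 2 -> p != 0 -> q != 0 -> p^* = p^-1 -> q^* = q^-1 ->
  X * q = s * (Y * p) <-> Y * p = s * (X * q).
Proof.
move=> Yr sr X0 XX p0 q0 pc qc.
have Xc0 : X^* != 0 by rewrite conjC_eq0.
have Y0 : Y != 0 by rewrite -sqrf_eq0 -XX mulf_neq0.
split=> e.
  have := congr1 (fun z : C => z^*) e.
  rewrite !rmorphM /= Yr sr pc qc => e'.
  apply: (mulfI Y0); rewrite mulrA -expr2 -XX.
  have -> : X * X^* * p = X * (X^* * q^-1) * (p * q) by field.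
  by rewrite e'; field.
have := congr1 (fun z : C => z^*) e.
rewrite !rmorphM /= Yr sr pc qc => e'.
apply: (mulfI Xc0).
have -> : X^* * (X * q) = Y * (Y * p^-1) * (p * q).
  by rewrite [LHS]mulrA (mulrC _ X) XX; field.
by rewrite e'; field; rewrite q0.
Qed.

Lemma cross_waveP h u v s :
    (u < n)%N != (v < n)%N -> beta h != 0 -> s^* = s ->
  wave (beta h) (r h) h (vtx v) = s * wave (beta h) (r h) h (vtx u)
    <-> s = l h * w ^+ (`|v%:Z - u%:Z|%N * h).
Proof.
move=> side b0 sr.
have rr : beta h * (beta h)^* = (r h) ^+ 2 by rewrite eta_rootE normCK.
have up p q : (p < n)%N -> (n <= q)%N ->
    r h * w ^+ (h * q) = s * (beta h * w ^+ (h * p))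
      <-> s = l h * w ^+ (`|q%:Z - p%:Z|%N * h).
  move=> pn nq; have -> : `|q%:Z - p%:Z|%N = (q - p)%N by lia.
  have qE : w ^+ (h * q) = w ^+ ((q - p) * h) * w ^+ (h * p).
    by rewrite -exprD (mulnC h p) -mulnDl subnK 1?mulnC //; lia.
  rewrite qE -(ell_mul b0); split=> [e|->]; last by ring.
  apply: (mulIf b0); apply: (mulIf (omega_exp_neq0 (h * p))).
  by rewrite -[LHS]mulrA -e; ring.
rewrite !wave_vertex; case: (ltnP u n) side => un; case: (ltnP v n) => // vn _.
  exact: up.
have -> : `|v%:Z - u%:Z|%N = `|u%:Z - v%:Z|%N by lia.
rewrite -(up v u vn un).
by apply: cross_wave_real; rewrite ?eta_root_conj ?omega_exp_neq0 ?omega_exp_conj.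
Qed.

Lemma cross_waveNP h u v s :
    (u < n)%N != (v < n)%N -> beta h != 0 -> s^* = s ->
  wave (beta h) (- r h) h (vtx v) = s * wave (beta h) (- r h) h (vtx u)
    <-> - s = l h * w ^+ (`|v%:Z - u%:Z|%N * h).
Proof.
move=> side b0 sr.
have sNr : (- s)^* = - s by rewrite rmorphN /= sr.
rewrite -(cross_waveP side b0 sNr).
rewrite !wave_vertex; case: (ltnP u n) side => un; case: (ltnP v n) => // vn _.
  by rewrite !mulNr; split=> [<-|->]; rewrite opprK.
by rewrite !mulNr mulrN.
Qed.

(** With beta = 0 the waves supported on one coset are modes, and such a wave
    takes a nonzero value at one of the two vertices only. *)
Lemma wave_cross_beta_neq0 h u v :
    (u < n)%N != (v < n)%N -> PST C (cayley S) (vtx u) (vtx v) tau ->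
  beta h != 0.
Proof.
move=> side pst; apply/eqP=> b0.
have := wave_of_PST pst (wave_mode0 1 0 b0).
have := wave_of_PST pst (wave_mode0 0 1 b0).
rewrite !wave_vertex; case: (ltnP u n) side => un; case: (ltnP v n) => // vn _.
  by rewrite mul1r mul0r mulr0 => /eqP; rewrite (negPf (omega_exp_neq0 _)).
by move=> _ /eqP; rewrite mul1r mul0r mulr0 (negPf (omega_exp_neq0 _)).
Qed.

Lemma eta_lcoset h j (X : {set gT}) : X \subset <[a]>%g ->
  eta R n a h (a ^+ j *: X)%g = w ^+ (h * j) * eta R n a h X.
Proof.
move/subsetP=> Xa; rewrite !eta_char mulr_sumr (reindex_inj (mulgI (a ^+ j)%g)) /=.
apply: eq_big => [x|x xX]; first by rewrite mem_lcoset mulKg.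
by rewrite rot_charM ?rot_charX // Xa; move: xX; rewrite mem_lcoset mulKg.
Qed.

Lemma eta_inj (X Y : {set gT}) : X \subset <[a]>%g -> Y \subset <[a]>%g ->
  (forall h, (h < n)%N -> eta R n a h X = eta R n a h Y) -> X = Y.
Proof.
move=> /subsetP Xa /subsetP Ya XY.
have ind k : (k < n)%N -> ((a ^+ k)%g \in X) = ((a ^+ k)%g \in Y).
  pose g k := (((a ^+ k)%g \in X)%:R - ((a ^+ k)%g \in Y)%:R : C).
  move=> kn; have : g k = 0.
    apply: (fourier_inj _ kn) => h hn.
    under eq_bigr do rewrite /g mulrBr.
    rewrite sumrB; apply/eqP; rewrite subr_eq0; apply/eqP.
    have := XY h hn; rewrite /eta big_mkcond [in RHS]big_mkcond /= => e.
    rewrite (eq_bigr (fun k : 'I_n => if (a ^+ k)%g \in X then w ^+ (h * k) else 0)).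
      rewrite e; apply: eq_bigr => i _.
      by case: ifP; rewrite ?mulr1 ?mulr0.
    by move=> i _; case: ifP; rewrite ?mulr1 ?mulr0.
  by rewrite /g => /eqP; rewrite subr_eq0 eqr_nat; do 2!case: (_ \in _).
apply/setP=> x; have [xa|xNa] := boolP (x \in <[a]>%g).
  case/cyclePmin: xa => k; rewrite order_rotation => kn ->; exact: ind.
have out (Z : {set gT}) : {subset Z <= <[a]>%g} -> (x \in Z) = false.
  by move=> Za; apply: contraNF xNa => /Za.
by rewrite !out.
Qed.

Lemma conn2_inv_sub : (conn2 a b S)^-1%g \subset <[a]>%g.
Proof.
by apply/subsetP=> x; rewrite mem_invg inE groupV => /andP [].
Qed.

(** T_tau(mu1) is real and equals l_h w^(jh), so beta T_tau(mu1) = r w^(jh);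
    comparing with the conjugate equation gives beta = w^(2jh) beta^*. *)
Lemma conn2_reflected u v :
    (u < n)%N != (v < n)%N -> PST C (cayley S) (vtx u) (vtx v) tau ->
  conn2 a b S = (a ^+ (2 * `|v%:Z - u%:Z|%N) *: (conn2 a b S)^-1)%g.
Proof.
move=> side pst; set j := `|_|%N.
apply: eta_inj; first exact: subsetIr.
  apply/subsetP=> x; rewrite mem_lcoset => /(subsetP conn2_inv_sub).
  by rewrite groupMl // groupV mem_cycle.
move=> h _; rewrite eta_lcoset ?conn2_inv_sub // eta_inv -/(beta h).
have b0 := wave_cross_beta_neq0 h side pst.
have sr := chebyshev_conj (mu1_conj h); set s := t _ in sr.
have := wave_of_PST pst (wave_mode1 h); rewrite (cross_waveP side b0 sr) -/s -/j.
rewrite mulnC => sE.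
have e : s * beta h = r h * w ^+ (h * j) by rewrite sE -(ell_mul b0); ring.
have := congr1 (fun z : C => z^*) e.
rewrite !rmorphM /= sr eta_root_conj omega_exp_conj => e'.
have r0 : r h != 0 by rewrite eta_rootE normr_eq0.
apply: (mulfI r0).
have -> : r h * beta h = (r h / w ^+ (h * j)) * beta h * w ^+ (h * j).
  by field; exact: omega_exp_neq0.
by rewrite -e' [s * _ * beta h]mulrAC e mulnCA mul2n -addnn exprD; ring.
Qed.

Lemma mu2_0 : mu2 R n a b S 0 = mut2 R a b S.
Proof.
rewrite /mu2 /mut2 eta_rootE /beta !eta0 ?subsetIr //.
by rewrite ger0_norm ?ler0n.
Qed.

Lemma mu1_0 : mu1 R n a b S 0 = mut1 R.
Proof.
rewrite /mu1 /mut1 eta_rootE /beta !eta0 ?subsetIr //.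
by rewrite ger0_norm ?ler0n // -natrD -card_conn divff // card_S_neq0.
Qed.

(** The index n - h carries the conjugate data of the index h, with the same
    eigenvalues. *)
Lemma beta_comp h : (h <= n)%N -> beta (n - h) = (beta h)^*.
Proof. exact: eta_comp. Qed.

Lemma eta_root_comp h : (h <= n)%N -> r (n - h) = r h.
Proof. by move=> hn; rewrite !eta_rootE beta_comp // norm_conjC. Qed.

Lemma mu1_comp h : (h <= n)%N -> mu1 R n a b S (n - h) = mu1 R n a b S h.
Proof.
move=> hn; rewrite /mu1 eta_root_comp // (eta_comp _ hn) -/(alpha h).
by rewrite eta_conn1_real.
Qed.

Lemma mu2_comp h : (h <= n)%N -> mu2 R n a b S (n - h) = mu2 R n a b S h.
Proof.
move=> hn; rewrite /mu2 eta_root_comp // (eta_comp _ hn) -/(alpha h).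
by rewrite eta_conn1_real.
Qed.

Lemma ell_comp h : (h <= n)%N -> beta h != 0 -> l (n - h) = (l h)^*.
Proof.
move=> hn b0; have b0' : beta (n - h) != 0 by rewrite beta_comp // conjC_eq0.
apply: (mulIf b0'); rewrite ell_mul // beta_comp // -rmorphM /= ell_mul //.
by rewrite eta_root_comp // eta_root_conj.
Qed.

Lemma omega_exp_comp j h : (h <= n)%N -> w ^+ (j * (n - h)) = (w ^+ (j * h))^*.
Proof.
move=> hn; rewrite omega_exp_conj; apply: (mulIf (omega_exp_neq0 (j * h))).
rewrite mulVf ?omega_exp_neq0 // -exprD -mulnDr subnK //.
by rewrite mulnC omega_expM.
Qed.

Lemma PST_crossP m u v : n = (2 * m + 1)%N -> (0 < m)%N ->
    (u < n)%N != (v < n)%N ->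
  PST C (cayley S) (vtx u) (vtx v) tau <->
  [/\ forall h, (1 <= h <= m)%N -> beta h <> 0,
      conn2 a b S = (a ^+ (2 * `|v%:Z - u%:Z|%N) *: (conn2 a b S)^-1)%g,
      t (mut1 R) = 1 /\ - t (mut2 R a b S) = 1
    & forall h, (1 <= h <= m)%N ->
        t (mu1 R n a b S h) = l h * w ^+ (`|v%:Z - u%:Z|%N * h)
        /\ - t (mu2 R n a b S h) = l h * w ^+ (`|v%:Z - u%:Z|%N * h)].
Proof.
move=> nE m0 side; set j := `|_|%N.
have sr1 h := chebyshev_conj (mu1_conj h).
have sr2 h := chebyshev_conj (mu2_conj h).
have l0 : beta 0 != 0 -> l 0 * w ^+ (j * 0) = 1.
  move=> b0; rewrite muln0 mulr1; apply: (mulIf b0).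
  by rewrite ell_mul // eta_rootE mul1r /beta eta0 ?subsetIr // ger0_norm ?ler0n.
split=> [pst|[b_neq0 _ [_ T2] cond]].
  have b0 h := wave_cross_beta_neq0 h side pst.
  have c1 h : t (mu1 R n a b S h) = l h * w ^+ (j * h).
    by apply/(cross_waveP side (b0 h) (sr1 h))/(wave_of_PST pst)/wave_mode1.
  have c2 h : - t (mu2 R n a b S h) = l h * w ^+ (j * h).
    by apply/(cross_waveNP side (b0 h) (sr2 h))/(wave_of_PST pst)/wave_mode2.
  split.
  - by move=> h _; apply/eqP.
  - exact: conn2_reflected.
  - by rewrite -mu2_0 c2 l0 // chebyshevT_at1.
  by [].
apply: PST_of_wave => [|h hn].
  apply/eqP=> e; move: side.
  by rewrite -!vertex_rotation e eqxx.
have goal h' : beta h' != 0 -> t (mu1 R n a b S h') = l h' * w ^+ (j * h') ->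
    - t (mu2 R n a b S h') = l h' * w ^+ (j * h') ->
    [/\ beta h' != 0,
      wave (beta h') (r h') h' (vtx v)
        = t (mu1 R n a b S h') * wave (beta h') (r h') h' (vtx u)
    & wave (beta h') (- r h') h' (vtx v)
        = t (mu2 R n a b S h') * wave (beta h') (- r h') h' (vtx u)].
  move=> b0 e1 e2; split=> //; first exact/(cross_waveP side b0 (sr1 h')).
  exact/(cross_waveNP side b0 (sr2 h')).
have [->|h0] := posnP h.
  have b0 : beta 0 != 0.
    rewrite /beta eta0 ?subsetIr // pnatr_eq0 cards_eq0.
    apply/eqP=> S20; have /b_neq0 : (1 <= 1 <= m)%N by [].
    by rewrite /beta S20 eta_char big_set0.
  by apply: goal => //; rewrite l0 // ?mu1_0 ?chebyshevT_at1 // mu2_0.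
have [hm|hm] := leqP h m.
  have hm' : (1 <= h <= m)%N by rewrite h0.
  by have [e1 e2] := cond _ hm'; apply: goal => //; apply/eqP/b_neq0.
pose k := (n - h)%N; have km : (1 <= k <= m)%N by rewrite /k; lia.
have kn : (k <= n)%N by rewrite leq_subr.
have hE : h = (n - k)%N by rewrite subKn // ltnW.
have /eqP bk := b_neq0 _ km; have [e1 e2] := cond _ km.
rewrite hE; apply: goal; first by rewrite beta_comp // conjC_eq0.
- by rewrite mu1_comp // ell_comp // omega_exp_comp // -rmorphM /= -e1 sr1.
by rewrite mu2_comp // ell_comp // omega_exp_comp // -rmorphM /= -e2 rmorphN /= sr2.
Qed.

Lemma mu_comp h : (h <= n)%N -> mu R n a S (n - h) = mu R n a S h.
Proof.
by move=> hn; rewrite /mu (eta_comp _ hn) -/(alpha h) eta_conn1_real.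
Qed.

(** * The equations of an antipodal transfer are inconsistent *)

Lemma rot_row_chebyshev h c :
    (beta h = 0 -> t (mu R n a S h) = c) ->
    (beta h <> 0 -> t (mu1 R n a b S h) = c /\ t (mu2 R n a b S h) = c) ->
  wave_row 1 0 h *m T = c *: wave_row 1 0 h.
Proof.
move=> c0 c12; have [b0|/eqP b0] := eqVneq (beta h) 0.
  by rewrite (wave_row_chebyshev (wave_mode0 1 0 b0)) c0.
have [c1 c2] := c12 b0; move/eqP: b0 => b0.
have -> : wave_row 1 0 h = (2 * beta h)^-1 *:
    (wave_row (beta h) (r h) h + wave_row (beta h) (- r h) h).
  by apply/rowP=> i; rewrite !mxE /wave; field.
rewrite -scalemxAl mulmxDl (wave_row_chebyshev (wave_mode1 h)) c1.
rewrite (wave_row_chebyshev (wave_mode2 h)) c2 -scalerDr scalerA mulrC.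
by rewrite -scalerA.
Qed.

Definition alternating_spectrum m :=
  [/\ forall h, (1 <= h <= m)%N -> beta h = 0 -> t (mu R n a S h) = (-1) ^+ h,
      forall h, (1 <= h <= m)%N -> beta h <> 0 ->
        t (mu1 R n a b S h) = (-1) ^+ h /\ t (mu2 R n a b S h) = (-1) ^+ h
    & t (mut2 R a b S) = 1].

(** n times the indicator of 1 is the sum of the rotation waves with indices
    |h| <= m (another Dirichlet kernel), and T scales the one of index h by
    (-1)^h. *)
Lemma alternating_circulant m : n = (2 * m + 1)%N ->
    alternating_spectrum m ->
  n%:R * T (enum_rank 1%g) (enum_rank a)
    = 1 + \sum_(1 <= h < m.+1) ((- w) ^+ h + (- w) ^- h).
Proof.
move=> nE [c0 c12 T2].
have Th h : (1 <= h <= m)%N -> wave_row 1 0 h *m T = (-1) ^+ h *: wave_row 1 0 h.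
  by move=> hm; apply: rot_row_chebyshev; [apply: c0|apply: c12].
have Tnh h : (1 <= h <= m)%N ->
    wave_row 1 0 (n - h) *m T = (-1) ^+ h *: wave_row 1 0 (n - h).
  move=> hm; have hn : (h <= n)%N by lia.
  apply: rot_row_chebyshev; rewrite ?mu_comp ?mu1_comp ?mu2_comp // beta_comp //.
    by move/eqP; rewrite conjC_eq0 => /eqP; apply: c0.
  by move=> /eqP; rewrite conjC_eq0 => /eqP; apply: c12.
have T0 : wave_row 1 0 0 *m T = wave_row 1 0 0.
  rewrite -[RHS]scale1r; apply: rot_row_chebyshev => [b0|_].
    have e : mu R n a S 0 = mut1 R.
      by rewrite -mu1_0 /mu1 /mu eta_rootE b0 normr0 addr0.
    by rewrite e chebyshevT_at1.
  by rewrite mu1_0 mu2_0 T2 chebyshevT_at1.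
(* the rotation waves of index between -m and m add up to n at 1, to 0 elsewhere *)
have delta1 : n%:R *: delta_mx 0 (enum_rank 1%g) = wave_row 1 0 0
    + \sum_(1 <= h < m.+1) (wave_row 1 0 h + wave_row 1 0 (n - h)).
  apply/rowP=> i; rewrite -(enum_valK i); set x := enum_val i.
  rewrite [RHS]mxE.
  have -> : (\sum_(1 <= h < m.+1) (wave_row 1 0 h + wave_row 1 0 (n - h)))
      0 (enum_rank x) = \sum_(1 <= h < m.+1) (chi h x + (chi h x)^*).
    rewrite summxE; apply: eq_big_nat => h hm.
    have hn : (h <= n)%N by lia.
    by rewrite !mxE /wave !mul0r !addr0 !mul1r enum_rankK rot_char_comp.
  have -> : wave_row 1 0 0 0 (enum_rank x) = (x \in <[a]>%g)%:R.
    by rewrite mxE /wave mul0r addr0 mul1r enum_rankK rot_char0.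
  rewrite !mxE eqxx /= (inj_eq enum_rank_inj).
  have [|xNa] := boolP (x \in <[a]>%g); last first.
    rewrite big1 => [|h _]; last by rewrite rot_char_out // conjC0 addr0.
    by case: eqP xNa => [->|_ _]; rewrite ?group1 // mulr0 addr0.
  case/cyclePmin=> k; rewrite order_rotation => kn ->.
  rewrite (eq_bigr (fun h => (w ^+ k) ^+ h + (w ^+ k) ^- h)) => [|h _]; last first.
    by rewrite rot_charX omega_exp_conj mulnC exprM.
  rewrite -(expg0 a) eq_expg_mod_order order_rotation mod0n modn_small //.
  have [->|k0] := posnP k.
    rewrite (eq_bigr (fun=> 2)) => [|h _]; last by rewrite expr0 !expr1n invr1.
    by rewrite sumr_const_nat subn1 /= mulr1 -mulrnA nE natrD addrC.
  rewrite mulr0; have := dirichlet_kernel m (omega_exp_neq0 k).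
  have -> : (w ^+ k) ^- m = (w ^+ k) ^+ m.+1.
    have wk0 := expf_neq0 m (omega_exp_neq0 k).
    apply: (mulIf wk0); rewrite mulVf // -[RHS]exprD -exprM mulnC.
    by rewrite (_ : (m.+1 + m)%N = n) ?omega_expM //; lia.
  rewrite subrr => /eqP; rewrite mulf_eq0 => /orP [/eqP -> //|].
  rewrite subr_eq0 eq_sym -(expr0 w) (eq_prim_root_expr (omega_primitive R n_gt0)).
  by rewrite mod0n modn_small // gtn_eqF.
have := congr1 (fun M : 'rV_#|gT| => (M *m T) 0 (enum_rank a)) delta1.
rewrite /= -scalemxAl -rowE [LHS]mxE [X in _ * X]mxE => ->.
rewrite mulmxDl T0 mulmx_suml mxE summxE; congr (_ + _).
  by rewrite mxE /wave mul0r addr0 mul1r enum_rankK rot_char0 cycle_id.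
apply: eq_big_nat => h hm; have hn : (h <= n)%N by lia.
rewrite mulmxDl Th // Tnh // !mxE /wave !mul0r !addr0 !mul1r enum_rankK.
rewrite rot_char_comp // -{1 2}(expg1 a) rot_charX muln1 omega_exp_conj.
by rewrite (exprNn w h) invfM invr_sign.
Qed.

Lemma chebyshev_cayley_rat x y : exists c : rat,
  T (enum_rank x) (enum_rank y) = ratr c.
Proof.
rewrite (discriminant_regular _ cayley_sym cayley_degree).
pose P0 : 'M[rat]_#|gT| :=
  \matrix_(i, j) ((cayley S (enum_val i) (enum_val j))%:R / #|S|%:R).
exists (chebyshev_mx P0 tau (enum_rank x) (enum_rank y)).
have -> : \matrix_(i, j) ((cayley S (enum_val i) (enum_val j))%:R / d)
    = map_mx (@ratr C) P0.
  by apply/matrixP=> i j; rewrite !mxE fmorph_div /= !ratr_nat.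
by rewrite -(map_chebyshev_mx (@ratr C)) mxE.
Qed.

(** By [dirichlet_kernel] at -w the sum D in [alternating_circulant] satisfies
    D (1 + w) = +-2 w^(m+1); with z = w^(m+1) and z^2 = w this reads
    z + 1/z = +-2 / D, a rational number. *)
Lemma alternating_triangle m : n = (2 * m + 1)%N -> (0 < m)%N ->
    alternating_spectrum m ->
  n = 3%N.
Proof.
move=> nE m0 alt.
have := alternating_circulant nE alt.
have [x ->] := chebyshev_cayley_rat 1%g a => xE.
have wN0 : - w != 0 by rewrite oppr_eq0 omega_neq0.
have := dirichlet_kernel m wN0; rewrite -xE opprK.
pose z := w ^+ m.+1.
have z0 : z != 0 by exact: omega_exp_neq0.
have zz : z ^+ 2 = w.
  by rewrite -exprM (_ : (m.+1 * 2)%N = n.+1) ?exprS ?wn ?mulr1 //; lia.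
have wVm : w ^- m = z.
  apply: (mulIf (omega_exp_neq0 m)); rewrite mulVf ?omega_exp_neq0 //.
  by rewrite -exprD (_ : (m.+1 + m)%N = n) ?wn //; lia.
rewrite (exprNn w m) invfM invr_sign wVm (exprNn w m.+1) -/z (exprS (-1)).
have -> : (-1) ^+ m * z - -1 * (-1) ^+ m * z = (-1) ^+ m * 2 * z :> C by ring.
rewrite -{1}zz => e.
have x0 : ratr x != 0 :> C.
  apply/eqP=> x0; move/eqP: e; rewrite x0 mulr0 mul0r eq_sym.
  by rewrite !mulf_eq0 signr_eq0 (negPf z0) pnatr_eq0.
have n0 : n%:R != 0 :> C by rewrite pnatr_eq0 -lt0n.
have zV : z + z^-1 = ratr ((-1) ^+ m * 2 / (n%:R * x)).
  rewrite fmorph_div !rmorphM /= rmorph_sign !ratr_nat.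
  apply: (mulfI (mulf_neq0 (mulf_neq0 n0 x0) z0)).
  transitivity (n%:R * ratr x * (1 + z ^+ 2)); first by field.
  by rewrite e; field; rewrite x0 n0.
have n_odd : odd n by rewrite nE oddD mul2n odd_double.
have zn : z ^+ n = 1 by rewrite exprAC wn expr1n.
have z3 := niven_odd n_odd zn zV.
have /eqP : w ^+ 3 = w ^+ 0 by rewrite -zz exprAC z3 expr1n expr0.
rewrite (eq_prim_root_expr (omega_primitive R n_gt0)) mod0n => n3.
have /dvdn_leq : (n %| 3)%N by exact: n3.
lia.
Qed.

(** S is the union of S_1, which is closed under conjugation because it is closed
    under inversion, and of none or all of the reflections. *)
Lemma normal_of_conn2 :
  conn2 a b S = set0 \/ conn2 a b S = <[a]>%g -> normal_connection S.
Proof.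
move=> S2.
have conj_rot g x : x \in <[a]>%g -> (x ^ g = x \/ x ^ g = x^-1)%g.
  move=> xa; have comm y : y \in <[a]>%g -> (x ^ y = x)%g.
    move=> ya; apply: conjg_fixP; apply/commgP.
    by case/cycleP: xa => i ->; case/cycleP: ya => j ->; apply: commuteX2.
  have [ga|gNa] := boolP (g \in <[a]>%g); first by left; apply: comm.
  right; have bga : (b * g)%g \in <[a]>%g by rewrite reflection_mem.
  have -> : g = (b * (b * g))%g by rewrite mulgA bb mul1g.
  have xb : (x ^ b = x^-1)%g by rewrite /conjg bV mulgA conj_rotation.
  by rewrite conjgM xb conjVg comm.
have S_conj g s : s \in S -> (s ^ g)%g \in S.
  move=> sS; have [sa|sNa] := boolP (s \in <[a]>%g).
    by case: (conj_rot g s sa) => ->; rewrite // S_inv mem_invg invgK.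
  have bs : (b * s)%g \in conn2 a b S.
    by rewrite inE mem_lcoset mulKg sS reflection_mem.
  case: S2 => S2; first by rewrite S2 inE in bs.
  have sgNa : (s ^ g)%g \notin <[a]>%g.
    apply: contra sNa => sga; rewrite -(conjgK g s).
    by case: (conj_rot g^-1%g _ sga) => ->; rewrite ?groupV.
  have : (b * s ^ g)%g \in conn2 a b S by rewrite S2 reflection_mem.
  by rewrite inE mem_lcoset mulKg => /andP [].
exists [set (s ^: [set: gT])%g | s in S]; split.
  by apply/subsetP=> _ /imsetP [s _ ->]; rewrite mem_classes ?inE.
apply/setP=> x; apply/idP/bigcupP => [xS|[_ /imsetP [s sS ->] /imsetP [g _ ->]]].
  by exists (x ^: [set: gT])%g; [apply: imset_f|apply: class_refl].
exact: S_conj.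
Qed.

(** For n = 3, non-normality leaves one or two reflections in S, so |beta| = 1,
    and S contains both nontrivial rotations or none. With one reflection only,
    mu1 = 1. With two reflections only, mut2 = -1 makes tau even, while
    mu1 = 1/2, where T_tau never takes the value -1 for even tau. With both
    rotations and one reflection, mut2 = 1/3, where T_tau never takes the value
    1. With both rotations and two reflections, mut2 = mu1 = 0. *)
Lemma triangle_impossible : n = 3%N -> 1%g \notin S -> ~ normal_connection S ->
    (beta 1 <> 0 ->
      t (mu1 R n a b S 1) = -1 /\ t (mu2 R n a b S 1) = -1) ->
    t (mut2 R a b S) = 1 ->
  False.
Proof.
move=> n3 S1 nonnormal c12 T2.
have S2_neq0 : conn2 a b S <> set0.
  by move=> e; apply/nonnormal/normal_of_conn2; left.
have S2_neqT : conn2 a b S <> <[a]>%g.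
  by move=> e; apply/nonnormal/normal_of_conn2; right.
have w3 : w ^+ 3 = 1 by rewrite -[X in _ ^+ X]n3.
have w1 : w != 1.
  rewrite -(expr0 w) -[X in X != _]expr1 (eq_prim_root_expr (omega_primitive R n_gt0)).
  by rewrite n3.
have w2 : w ^+ 2 = - 1 - w.
  have w10 : w - 1 != 0 by rewrite subr_eq0.
  apply: (mulfI w10); have -> : (w - 1) * w ^+ 2 = w ^+ 3 - w ^+ 2 by ring.
  by rewrite w3; ring.
have wc : w^* = w ^+ 2.
  rewrite omega_conj; apply: (mulIf omega_neq0).
  by rewrite mulVf ?omega_neq0 // -exprSr w3.
have a3 : (a ^+ 3 = 1)%g by rewrite -[X in (_ ^+ X)%g]n3.
have etaE h (X : {set gT}) : eta R n a h X =
    (1%g \in X)%:R + (a \in X)%:R * w ^+ h + ((a ^+ 2)%g \in X)%:R * w ^+ (h * 2).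
  rewrite /eta big_mkcond n3 !big_ord_recl big_ord0 /= /bump /= expg0 expg1.
  rewrite muln0 muln1 expr0 addr0 addrA.
  by do 3!case: (_ \in _); rewrite ?mul1r ?mul0r.
have S2_sub : conn2 a b S \subset <[a]>%g := subsetIr _ _.
have a2S : ((a ^+ 2)%g \in S) = (a \in S).
  rewrite [in LHS]S_inv mem_invg -[in RHS](expg1 a); congr (_ \in S).
  by apply/eqP; rewrite eq_invg_mul -expgD; apply/eqP; exact: a3.
have S1E h : eta R n a h (conn1 a S) = (a \in S)%:R * (w ^+ h + w ^+ (h * 2)).
  rewrite etaE !inE (negPf S1) cycle_id mem_cycle !andbT a2S /=.
  by rewrite add0r mulrDr.
have s1E : #|conn1 a S|%:R = (a \in S)%:R * 2 :> C.
  by rewrite -eta0 ?subsetIr // S1E.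
have aE : alpha 1 = - (a \in S)%:R.
  by rewrite /alpha S1E mul1n expr1 w2; ring.
have [k k12 s2E] : exists2 k : nat, (k == 1%N) || (k == 2%N) & #|conn2 a b S| = k.
  exists #|conn2 a b S| => //.
  have: (0 < #|conn2 a b S|)%N by rewrite card_gt0; apply/eqP.
  have: (#|conn2 a b S| < 3)%N.
    rewrite -[X in (_ < X)%N]n3 -order_rotation proper_card // properEneq S2_sub andbT.
    exact/eqP.
  by case: #|_| => [|[|[|]]].
have s2Ek : k%:R = (1%g \in conn2 a b S)%:R + (a \in conn2 a b S)%:R
    + ((a ^+ 2)%g \in conn2 a b S)%:R :> C.
  by rewrite -s2E -eta0 // etaE !mul0n expr0 !mulr1.
have bE : beta 1 * (beta 1)^* = 1.
  rewrite /beta etaE mul1n expr1 !rmorphD !rmorphM /= wc !conjC_nat.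
  have {}s2Ek : k = ((1%g \in conn2 a b S) + (a \in conn2 a b S)
    + ((a ^+ 2)%g \in conn2 a b S))%N.
    by apply/eqP; rewrite -(eqr_nat C) s2Ek !natrD.
  have w4 : w ^+ 2 * w ^+ 2 = w by rewrite -exprD exprSr w3 mul1r.
  (* |beta|^2 - 1 is a multiple of w^2 + w + 1 for each choice of the subset *)
  have w0 : w ^+ 2 + w + 1 = 0 by rewrite w2; ring.
  have reduce (x c : C) : x - 1 = c * (w ^+ 2 + w + 1) -> x = 1.
    by rewrite w0 mulr0 => /eqP; rewrite subr_eq0 => /eqP.
  rewrite w4; move: s2Ek k12; do 3!case: (_ \in _) => /=; move=> -> // _.
  - by apply: (reduce _ w); ring.
  - by apply: (reduce _ w); ring.
  - by apply: (reduce _ 0); ring.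
  - by apply: (reduce _ (w ^+ 2 + w - 1)); ring.
  - by apply: (reduce _ (w - 1)); ring.
  by apply: (reduce _ (w - 1)); ring.
have r1 : r 1 = 1.
  by apply/eqP; rewrite eta_rootE -(@pexpr_eq1 _ _ 2) // normCK bE.
have beta_neq0 : beta 1 <> 0.
  by move=> b0; move/eqP: bE; rewrite b0 mul0r eq_sym oner_eq0.
have [T1 _] := c12 beta_neq0.
have one_neq : 1 <> - 1 :> C.
  by move/eqP; rewrite -subr_eq0 opprK -mulr2n pnatr_eq0.
move: T1 T2; rewrite /mu1 /mut2 -/(alpha 1) r1 aE card_conn natrD s1E s2E.
case: (a \in S); case/orP: k12 => /eqP ->; rewrite ?mul1r ?mul0r.
- rewrite addNr mul0r => _.
  have -> : (2 - 1) / (2 + 1) = ratr (2 / 3 : rat) / 2 :> C.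
    by rewrite fmorph_div /= !ratr_nat; field.
  case/(int_of_chebyshevT_rat tau_gt0) => z zE.
  have /intr_inj : 2%:~R = (3 * z)%:~R :> C.
    by rewrite intrM -zE fmorph_div /= !ratr_nat; field.
  by lia.
- rewrite addNr subrr !mul0r => -> e; exact: one_neq.
- by rewrite add0r oppr0 add0r divr1 chebyshevT_at1.
rewrite !add0r oppr0 add0r => T1.
have -> : - 2 / 2 = - 1 :> C by field.
rewrite chebyshevT_opp chebyshevT_at1 mulr1 -signr_odd.
case: (boolP (odd tau)) => [_ /esym|/even_halfK tau_even _]; first exact: one_neq.
by have := chebyshevT_half_even C tau./2; rewrite mul2n tau_even T1 eqxx.
Qed.

Lemma alternating_impossible m : n = (2 * m + 1)%N -> (0 < m)%N ->
    1%g \notin S -> ~ normal_connection S ->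
  ~ alternating_spectrum m.
Proof.
move=> nE m0 S1 nonnormal alt.
have n3 := alternating_triangle nE m0 alt; have [_ c12 T2] := alt.
by apply: (triangle_impossible n3 S1 nonnormal _ T2); apply: c12.
Qed.

End Dihedral.

Theorem theorem4p5 (R : realType) (m n : nat) (hm : (0 < m)%N)
    (hn : n = (2 * m + 1)%N)
    (a b : ('D_(2 * n))%type) (hab : dihedral_pair n a b)
    (S : {set ('D_(2 * n))%type})
    (S_neq0 : S != set0) (S_1 : 1%g \notin S) (S_inv : S = (S^-1)%g)
    (S_nonnormal : ~ normal_connection S)
    (u v : 'I_(2 * n)) (tau : nat) (htau : (0 < tau)%N) :
  PST R[i] (cayley S) (vertex_of_label n a b u) (vertex_of_label n a b v) tau
  <->
  exactly_one
    [/\ ((u < n)%N /\ (v < n)%N) \/ ((n <= u)%N /\ (n <= v)%N),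
        u%:Z - v%:Z = m%:Z \/ u%:Z - v%:Z = - m%:Z,
        (chebyshevT R[i] tau).[mut1 R] = 1
          /\ (chebyshevT R[i] tau).[mut2 R a b S] = 1,
        (forall h : nat, (1 <= h <= m)%N -> eta R n a h (conn2 a b S) = 0 ->
           (chebyshevT R[i] tau).[mu R n a S h] = (-1) ^+ h)
      & (forall h : nat, (1 <= h <= m)%N -> eta R n a h (conn2 a b S) <> 0 ->
           (chebyshevT R[i] tau).[mu1 R n a b S h] = (-1) ^+ h
           /\ (chebyshevT R[i] tau).[mu2 R n a b S h] = (-1) ^+ h)]
    [/\ ((u < n)%N /\ (n <= v)%N) \/ ((n <= u)%N /\ (v < n)%N),
        (forall h : nat, (1 <= h <= m)%N -> eta R n a h (conn2 a b S) <> 0),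
        conn2 a b S = (a ^+ (2 * `|v - u|%N) *: (conn2 a b S)^-1)%g,
        (chebyshevT R[i] tau).[mut1 R] = 1
          /\ - (chebyshevT R[i] tau).[mut2 R a b S] = 1
      & (forall h : nat, (1 <= h <= m)%N ->
           (chebyshevT R[i] tau).[mu1 R n a b S h]
             = ell R n a b S h * omega R n ^+ (`|v - u|%N * h)
           /\ - (chebyshevT R[i] tau).[mu2 R n a b S h]
             = ell R n a b S h * omega R n ^+ (`|v - u|%N * h))].
Proof.
have n0 : (0 < n)%N by lia.
have n_odd : odd n by rewrite hn oddD mul2n odd_double.
have card_D : #|[set: ('D_(2 * n))%type]| = (2 * n)%N.
  by rewrite mul2n card_dihedral; lia.
have crossP x y := @PST_crossP _ _ _ _ n0 hab card_D R _ S_inv S_neq0 _ htau m x y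
  hn hm.
have noA := @alternating_impossible _ _ _ _ n0 hab card_D R _ S_inv S_neq0 _ htau m
  hn hm S_1 S_nonnormal.
split=> [pst|].
  have side := PST_changes_side n0 hab card_D S_inv S_neq0 htau n_odd
    (ltn_ord u) (ltn_ord v) pst.
  right; split; first by case=> _ _ [_ T2] c0 c12; apply: noA.
  have [b0 S2 T c] := (crossP u v side).1 pst.
  split=> //; move: side.
  by case: (ltnP u n); case: (ltnP v n) => // *; [left|right].
case=> [[[_ _ [_ T2] c0 c12] _]|[_ [side b0 S2 T c]]]; first by case: noA.
apply/crossP => //.
by case: side => -[]; case: ltnP => // _; case: ltnP.
Qed.
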